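(* Let $0\le m<M<\infty$. For $x=(x_1,x_2,x_3)$ with $x_1^2\le x_2$, $m<x_3\le M$, put $$B(x_1,x_2,x_3;m,M)=\frac{(x_3-m)\,x_2}{\bigl[1-2a(M-m)\bigr]^2\bigl[1-4a(M-x_3)\bigr]}+m\,x_2,$$ where $a=a(x)$ is the unique solution on the interval $\bigl[0,\frac1{4(M-m)}\bigr]$ of the cubic equation $$\frac{x_1^2}{x_2}=\left[\frac{1-2a(M-x_3)}{1-2a(M-m)}\right]^2\frac{1-4a(M-m)}{1-4a(M-x_3)}$$ (for $x_1=x_2=0$, where the left-hand side is undefined, $B$ is understood to be $0$). Then the Bellman function $\mathbf B_{CET}$ of the dyadic Carleson embedding theorem is given by $$\mathbf B_{CET}(x;m,M)=\begin{cases}B(x;m,M), & x_1^2\le x_2,\ m<x_3\le M,\\ m\,x_2, & x_1^2\le x_2,\ x_3=m.\end{cases}$$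
   Context: Let $I\subset\mathbb R$ be a bounded interval. $D(I)$ denotes the dyadic lattice of subintervals of $I$: $I$ itself, its left and right halves, the left and right halves of these, and so on. $|J|$ is the length of $J$, and $\langle\phi\rangle_J=\frac1{|J|}\int_J\phi(t)\,dt$. For $x=(x_1,x_2,x_3)$ with $x_1^2\le x_2$ and $m\le x_3\le M$, define $$\mathbf B_{CET}(x_1,x_2,x_3;m,M):=\sup\frac1{|I|}\Bigl\{\int_I|\phi(t)|^2\,d\mu(t)+\sum_{J\in D(I)}|\langle\phi\rangle_J|^2\alpha_J\Bigr\},$$ where the supremum is over all real-valued square-integrable functions $\phi$ on $I$, all non-negative measures $\mu$ on $I$ without atoms, and all families $\{\alpha_J\}_{J\in D(I)}$ of non-negative numbers satisfying $$\langle\phi\rangle_I=x_1,\qquad \langle\phi^2\rangle_I=x_2,\qquad \frac1{|I|}\Bigl(\mu(I)+\sum_{J\in D(I)}\alpha_J\Bigr)=x_3,$$ $$m|J|\le\mu(J)+\sum_{\ell\in D(J)}\alpha_\ell\le M|J|\quad\text{for all }J\in D(I).$$ The value does not depend on the choice of $I$. *)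

(* Defs.v *)
From HB Require Import structures.
From mathcomp Require Import all_boot all_order all_algebra.
From mathcomp Require Import all_classical all_reals all_analysis.

Set Implicit Arguments.
Unset Strict Implicit.
Unset Printing Implicit Defensive.

Import Order.TTheory GRing.Theory Num.Theory.
Import numFieldNormedType.Exports.

Local Open Scope classical_set_scope.
Local Open Scope ring_scope.

(* The midpoint is put in the right half, so that the two halves partition J;
   the measures considered below do not charge points, so this choice is
   immaterial. *)
Definition left_half (R : realType) (J : interval R) : interval R :=
  let: Interval l _ := J in Interval l (BLeft (miditv J)).

Definition right_half (R : realType) (J : interval R) : interval R :=
  let: Interval _ r := J in Interval (BLeft (miditv J)) r.

Inductive dyadic (R : realType) (I : interval R) : set (interval R) :=
| dyadic_self : dyadic I I
| dyadic_left J : dyadic I J -> dyadic I (left_half J)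
| dyadic_right J : dyadic I J -> dyadic I (right_half J).

Definition len (R : realType) (J : interval R) : R :=
  fine (lebesgue_measure [set` J]).

Definition avg (R : realType) (J : interval R) (phi : R -> R) : R :=
  (len J)^-1 * \int[lebesgue_measure]_(t in [set` J]) phi t.

Definition square_integrable (R : realType) (I : interval R) (phi : R -> R) :=
  measurable_fun [set` I] phi /\
  (@lebesgue_measure R).-integrable [set` I] (fun t => (phi t ^+ 2)%:E).

(* A measure on I is represented by a Borel measure on the line, of which only
   the values on Borel subsets of I are ever used. *)
Definition no_atoms (R : realType) (I : interval R)
    (mu : {measure set (measurableTypeR R) -> \bar R}) :=
  forall t : R, t \in I -> mu [set t] = 0%E.

Definition carleson_mass (R : realType)
    (mu : {measure set (measurableTypeR R) -> \bar R})
    (alpha : interval R -> R) (J : interval R) : \bar R :=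
  (mu [set` J] + \esum_(K in dyadic J) (alpha K)%:E)%E.

(* Only the values of phi on I and of alpha on the dyadic lattice of I matter. *)
Definition admissible (R : realType) (I : interval R) (m M x1 x2 x3 : R)
    (phi : R -> R) (mu : {measure set (measurableTypeR R) -> \bar R})
    (alpha : interval R -> R) : Prop :=
  [/\ [/\ square_integrable I phi,
          no_atoms I mu &
          forall J, dyadic I J -> 0 <= alpha J],
      avg I phi = x1,
      avg I (fun t => phi t ^+ 2) = x2,
      ((len I)^-1%:E * carleson_mass mu alpha I = x3%:E)%E &
      forall J, dyadic I J ->
        ((m * len J)%:E <= carleson_mass mu alpha J <= (M * len J)%:E)%E].

Definition carleson_value (R : realType) (I : interval R) (phi : R -> R)
    (mu : {measure set (measurableTypeR R) -> \bar R})
    (alpha : interval R -> R) : \bar R :=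
  ((len I)^-1%:E *
   (\int[mu]_(t in [set` I]) (`|phi t| ^+ 2)%:E +
    \esum_(J in dyadic I) (`|avg J phi| ^+ 2 * alpha J)%:E))%E.

Definition bellman_CET (R : realType) (I : interval R) (x1 x2 x3 m M : R)
    : \bar R :=
  ereal_sup [set v | exists phi mu alpha,
    admissible I m M x1 x2 x3 phi mu alpha /\
    v = carleson_value I phi mu alpha].

Definition solves_cubic (R : realType) (x1 x2 x3 m M a : R) : Prop :=
  0 <= a <= (4 * (M - m))^-1 /\
  x1 ^+ 2 / x2 =
    ((1 - 2 * a * (M - x3)) / (1 - 2 * a * (M - m))) ^+ 2 *
    ((1 - 4 * a * (M - m)) / (1 - 4 * a * (M - x3))).

Definition cubic_root (R : realType) (x1 x2 x3 m M : R) : R :=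
  xget 0 [set a | solves_cubic x1 x2 x3 m M a].

Definition bellman_B (R : realType) (x1 x2 x3 m M : R) : R :=
  if (x1 == 0) && (x2 == 0) then 0 else
  let a := cubic_root x1 x2 x3 m M in
  (x3 - m) * x2 /
    ((1 - 2 * a * (M - m)) ^+ 2 * (1 - 4 * a * (M - x3))) + m * x2.

(* Main.v *)
Require Import Defs.
From HB Require Import structures.
From mathcomp Require Import all_boot all_order all_algebra.
From mathcomp Require Import all_classical all_reals all_analysis.
From mathcomp Require Import measurable_realfun ring lra.
Import Order.TTheory GRing.Theory Num.Theory.
Import numFieldNormedType.Exports.
Set Implicit Arguments.
Unset Strict Implicit.
Unset Printing Implicit Defensive.
Local Open Scope classical_set_scope.
Local Open Scope ring_scope.

(* Upper bound: B is the infimum over 0 < a <= 1 / (4 (M - m)) of the elementary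
   majorants
     m x2 + (x2 / (1 - 2 a (M - m)) - x1^2 / (1 - 2 a (M - x3))) / (2 a),
   the infimum being attained where a solves the cubic. Each of them is concave,
   because x1^2 / s is jointly convex, and its x3-derivative is at least x1^2; so
   Bellman induction along the dyadic tree bounds the Carleson sum by it. The
   measure mu is dominated by M times Lebesgue measure, so dyadic averages of phi
   converge mu-almost everywhere and Fatou's lemma recovers the integral of phi^2
   against mu.

   Lower bound: after removing m x2 and rescaling, m = 0 and M = 1. Along the
   extremal lines, where a is constant, x is a convex combination of a point
   (c, r c^2, 1), r = (1 - 2 a)^2 / (1 - 4 a), and of a point (y, y^2, 0). On the
   top face one lowers x3 by d = 2^-k, collecting c^2 d, and splits the result
   along such a line into (c', r c'^2, 1), c' = c (1 + 2 a d), with weight 1 - d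
   and a point with x3 = 0. By homogeneity the best constant K on the top face
   then satisfies d + (1 - d) (1 + 2 a d)^2 K <= K, hence K >= 1 / (1 - 4 a) as d
   tends to 0. *)

(** * Elementary majorants of the Bellman function *)

(** The gap between the two sides is the square [(p * t - q * s) ^+ 2] over a positive
    denominator. *)
Lemma sqr_div_midpoint_convex (R : realFieldType) (p q s t : R) :
  0 < s -> 0 < t ->
  ((p + q) / 2) ^+ 2 / ((s + t) / 2) <= (p ^+ 2 / s + q ^+ 2 / t) / 2.
Proof.
move=> s0 t0; have st0 : 0 < s + t by exact: addr_gt0.
have -> : (p ^+ 2 / s + q ^+ 2 / t) / 2 = ((p + q) / 2) ^+ 2 / ((s + t) / 2)
    + (p * t - q * s) ^+ 2 / (2 * s * t * (s + t)).
  by field; rewrite !gt_eqF.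
by rewrite lerDl divr_ge0 ?sqr_ge0// !mulr_ge0// ltW.
Qed.

Definition majorant (R : realFieldType) (a m M x1 x2 x3 : R) : R :=
  m * x2 + (2 * a)^-1 *
    (x2 / (1 - 2 * a * (M - m)) - x1 ^+ 2 / (1 - 2 * a * (M - x3))).

Lemma majorant_denom (R : realFieldType) (a m M x3 : R) :
  m < M -> 0 < a -> a <= (4 * (M - m))^-1 -> m <= x3 -> x3 <= M ->
  [/\ 0 < 1 - 2 * a * (M - m), 1 - 2 * a * (M - m) <= 1 - 2 * a * (M - x3) &
      1 - 2 * a * (M - x3) <= 1].
Proof.
move=> mM a0 aM mx xM.
have D0 : 0 < M - m by lra.
have : a * (M - m) <= 1/4.
  move: aM; rewrite -(ler_pM2r D0) => /le_trans; apply.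
  by rewrite invfM -mulrA mulVf ?gt_eqF//; lra.
by move=> H; split; nra.
Qed.

(** The estimate at the leaves of the Bellman induction. Once [x2] is lowered to [x1 ^+ 2], the
    second term of [majorant] becomes [x1 ^+ 2 * (x3 - m) / (s * t)], and [s] and [t] are at most
    1. *)
Lemma majorant_ge (R : realFieldType) (a m M x1 x2 x3 : R) :
  0 <= m -> m < M -> 0 < a -> a <= (4 * (M - m))^-1 ->
  x1 ^+ 2 <= x2 -> m <= x3 -> x3 <= M ->
  x1 ^+ 2 * x3 <= majorant a m M x1 x2 x3.
Proof.
move=> m0 mM a0 aM x12 mx xM.
have [t0 ts s1] := majorant_denom mM a0 aM mx xM.
rewrite /majorant; set t := 1 - 2 * a * (M - m) in t0 ts *.
set s := 1 - 2 * a * (M - x3) in ts s1 *.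
have s0 : 0 < s by exact: lt_le_trans ts.
have h : x1 ^+ 2 * (x3 - m) <= (2 * a)^-1 * (x1 ^+ 2 / t - x1 ^+ 2 / s).
  have -> : (2 * a)^-1 * (x1 ^+ 2 / t - x1 ^+ 2 / s) =
      x1 ^+ 2 * (x3 - m) / (s * t).
    have -> : x3 - m = (s - t) / (2 * a).
      by rewrite /s /t; field; rewrite gt_eqF.
    by field; rewrite !gt_eqF.
  rewrite ler_pdivlMr ?mulr_gt0// ler_piMr//.
    by rewrite mulr_ge0 ?sqr_ge0 ?subr_ge0.
  by rewrite mulr_ile1 ?(ltW s0) ?(ltW t0) ?(le_trans ts)//.
have h2 : (2 * a)^-1 * (x1 ^+ 2 / t - x1 ^+ 2 / s) <=
          (2 * a)^-1 * (x2 / t - x1 ^+ 2 / s).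
  rewrite ler_pM2l ?invr_gt0 ?mulr_gt0// lerD2r.
  by rewrite ler_pM2r ?invr_gt0.
have h3 : m * x1 ^+ 2 <= m * x2 by exact: ler_wpM2l.
lra.
Qed.

(** The estimate at a node, in two moves. Midpoint concavity ([hc]) leads to the denominator [w];
    raising the third variable by [d] then gains [p ^+ 2 * d / (w * (w + 2 * a * d))], at least
    [p ^+ 2 * d] because both factors are at most 1 ([hd]). *)
Lemma majorant_main (R : realFieldType) (a m M x1 x2 x3 y1 y2 y3 d : R) :
  m < M -> 0 < a -> a <= (4 * (M - m))^-1 ->
  m <= x3 -> m <= y3 -> 0 <= d -> (x3 + y3) / 2 + d <= M ->
  (majorant a m M x1 x2 x3 + majorant a m M y1 y2 y3) / 2 +
    ((x1 + y1) / 2) ^+ 2 * d <=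
  majorant a m M ((x1 + y1) / 2) ((x2 + y2) / 2) ((x3 + y3) / 2 + d).
Proof.
move=> mM a0 aM mx my d0 xM.
have D0 : 0 < M - m by lra.
have aD : a * (M - m) <= 1/4.
  move: aM; rewrite -(ler_pM2r D0) => /le_trans; apply.
  by rewrite invfM -mulrA mulVf ?gt_eqF//; lra.
rewrite /majorant; set t := 1 - 2 * a * (M - m).
set s := 1 - 2 * a * (M - x3); set r := 1 - 2 * a * (M - y3).
have s0 : 0 < s by rewrite /s; nra.
have r0 : 0 < r by rewrite /r; nra.
have -> : 1 - 2 * a * (M - ((x3 + y3) / 2 + d)) = (s + r) / 2 + 2 * a * d.
  by rewrite /s /r; field.
have w1 : (s + r) / 2 + 2 * a * d <= 1 by rewrite /s /r; nra.
set w := (s + r) / 2 in w1 *; set p := (x1 + y1) / 2.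
have w0 : 0 < w by rewrite divr_gt0// addr_gt0.
have ad0 : 0 <= 2 * a * d by rewrite !mulr_ge0 // ltW.
have wd0 : 0 < w + 2 * a * d by rewrite ltr_wpDr.
have hd : p ^+ 2 * d <= (2 * a)^-1 * (p ^+ 2 / w - p ^+ 2 / (w + 2 * a * d)).
  have -> : (2 * a)^-1 * (p ^+ 2 / w - p ^+ 2 / (w + 2 * a * d)) =
      p ^+ 2 * d / (w * (w + 2 * a * d)).
    by field; rewrite !gt_eqF.
  rewrite ler_pdivlMr; last exact: mulr_gt0.
  rewrite ler_piMr ?(mulr_ge0 (sqr_ge0 p) d0)//.
  by rewrite mulr_ile1 ?(ltW w0) ?(ltW wd0)//; apply: le_trans w1; rewrite lerDl.
have hc : (2 * a)^-1 * (p ^+ 2 / w) <=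
    (2 * a)^-1 * ((x1 ^+ 2 / s + y1 ^+ 2 / r) / 2).
  rewrite ler_pM2l ?invr_gt0 ?mulr_gt0//.
  exact: sqr_div_midpoint_convex.
move: hd hc; rewrite !mulrBr !mulrDl !mulrDr.
set c := (2 * a)^-1; set k := t^-1 => hd hc.
lra.
Qed.

(** * The cubic equation *)

(** With [D = M - m] and [u = M - x3], the right-hand side of the cubic equation is
    [cubic_num D u a / cubic_den D u a]. *)
Definition cubic_num (R : realType) (D u a : R) : R :=
  (1 - 2 * a * u) ^+ 2 * (1 - 4 * a * D).

Definition cubic_den (R : realType) (D u a : R) : R :=
  (1 - 2 * a * D) ^+ 2 * (1 - 4 * a * u).

Section cubic.
Variable R : realType.
Implicit Types a u D : R.
Local Notation P := (@cubic_num R).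
Local Notation Q := (@cubic_den R).


Lemma cubic_ratio_decreasing D u a b :
  0 <= u -> u < D -> 0 <= a -> a < b -> 4 * b * D <= 1 ->
  P D u b * Q D u a < P D u a * Q D u b.
Proof.
move=> u0 uD a0 ab bD.
have D0 : 0 < D by exact: le_lt_trans uD.
have b0 : 0 < b by exact: le_lt_trans ab.
have aD : 4 * a * D < 1.
  by apply: lt_le_trans bD; rewrite ltr_pM2r// ltr_pM2l.
have bu : 4 * b * u <= 1.
  by apply: le_trans bD; rewrite ler_pM2l ?mulr_gt0// ltW.
have au : 4 * a * u <= 1.
  by apply: le_trans (ltW aD); rewrite ler_wpM2l ?mulr_ge0// ltW.
(* Q - P is a positive multiple of E, which increases while P decreases. *)
pose E c := c ^+ 2 * ((D + u) - 4 * c * u * D).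
have QE c : Q D u c = P D u c + 4 * (D - u) * E c.
  by rewrite /cubic_den /cubic_num /E; ring.
have Pa : 0 < P D u a.
  rewrite /cubic_num mulr_gt0 ?exprn_gt0 ?subr_gt0//; lra.
have Pb : 0 <= P D u b by rewrite /cubic_num mulr_ge0 ?sqr_ge0// subr_ge0.
have PP : P D u b <= P D u a.
  rewrite /cubic_num ler_pM ?sqr_ge0 ?subr_ge0//.
    by rewrite ler_sqr ?nnegrE; nra.
  by rewrite lerD2l lerN2 ler_pM2r// ler_pM2l// ltW.
have Ea : 0 <= E a.
  by rewrite /E mulr_ge0 ?sqr_ge0//; nra.
have EE : E a < E b.
  rewrite -subr_gt0.
  have -> : E b - E a = (b - a) *
     ((a + b) * (D + u) - (4 * b * D) * u * b - (4 * a * D) * u * (b + a)).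
    by rewrite /E; ring.
  apply: mulr_gt0; first by rewrite subr_gt0.
  (* As [4 * a * D] and [4 * b * D] are at most 1, the bracket is at least [(a + b) * D - u * a],
     which is positive. *)
  have h1 : 4 * b * D * (u * b) <= 1 * (u * b).
    by apply: ler_wpM2r => //; rewrite mulr_ge0// ltW.
  have h2 : 4 * a * D * (u * a) <= 1 * (u * a).
    by apply: ler_wpM2r (ltW aD); rewrite mulr_ge0.
  have h3 : 4 * b * D * (u * a) <= 1 * (u * a).
    by apply: ler_wpM2r => //; rewrite mulr_ge0.
  have h4 : u * (a + b) < D * (a + b).
    by rewrite ltr_pM2r// ltr_wpDl.
  have h5 : u * a < D * b.
    by apply: (le_lt_trans (y := u * b)); [rewrite ler_wpM2l// ltW | rewrite ltr_pM2r].
  have h6 : 0 <= D * a by rewrite mulr_ge0// ltW.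
  have ->: 4 * a * D * u * (b + a) = 4 * b * D * (u * a) + 4 * a * D * (u * a) by ring.
  have ->: 4 * b * D * u * b = 4 * b * D * (u * b) by ring.
  move: h1 h2 h3; set X1 := 4 * b * D * _; set X2 := 4 * a * D * _; set X3 := 4 * b * D * _.
  lra.
rewrite !QE -subr_gt0.
have -> : P D u a * (P D u b + 4 * (D - u) * E b) -
    P D u b * (P D u a + 4 * (D - u) * E a) =
    4 * (D - u) * (P D u a * E b - P D u b * E a) by ring.
rewrite !mulr_gt0 ?subr_gt0//.
apply: (le_lt_trans (y := P D u a * E a)); first exact: ler_wpM2r.
by rewrite ltr_pM2l.
Qed.

Lemma cubic_denom_gt0 D u a : 0 <= u -> u < D -> 0 <= a -> a <= (4 * D)^-1 ->
  [/\ 4 * a * D <= 1, 0 < 1 - 2 * a * D & 0 < 1 - 4 * a * u].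
Proof.
move=> u0 uD a0 aD.
have D0 : 0 < D by exact: le_lt_trans uD.
have h : 4 * a * D <= 1.
  move: aD; rewrite -(ler_pM2r (_ : 0 < 4 * D)) ?mulr_gt0// mulVf ?gt_eqF ?mulr_gt0//.
  by lra.
split => //; first by lra.
rewrite subr_gt0; move: a0; rewrite le_eqVlt => /predU1P[<-|a0]; first by lra.
by apply: lt_le_trans h; rewrite ltr_pM2l// mulr_gt0.
Qed.

(** Denominators can be cleared on the whole closed range of [a]: since [m < x3], the factor
    [1 - 4 * a * (M - x3)] stays positive even at the right endpoint. *)
Lemma solves_cubicE (x1 x2 x3 m M a : R) : m < x3 -> x3 <= M ->
  0 < x2 -> 0 <= a <= (4 * (M - m))^-1 ->
  x1 ^+ 2 / x2 = ((1 - 2 * a * (M - x3)) / (1 - 2 * a * (M - m))) ^+ 2 *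
    ((1 - 4 * a * (M - m)) / (1 - 4 * a * (M - x3))) <->
  P (M - m) (M - x3) a * x2 = x1 ^+ 2 * Q (M - m) (M - x3) a.
Proof.
move=> mx xM x20 /andP[a0 aM].
have uD : M - x3 < M - m by lra.
have u0 : 0 <= M - x3 by lra.
have [_ t0 s0] := cubic_denom_gt0 u0 uD a0 aM.
have Q0 : 0 < Q (M - m) (M - x3) a by rewrite /cubic_den mulr_gt0// exprn_gt0.
have -> : ((1 - 2 * a * (M - x3)) / (1 - 2 * a * (M - m))) ^+ 2 *
    ((1 - 4 * a * (M - m)) / (1 - 4 * a * (M - x3))) =
    P (M - m) (M - x3) a / Q (M - m) (M - x3) a.
  by rewrite /cubic_num /cubic_den; field; rewrite !gt_eqF.
have x2n : x2 != 0 by rewrite gt_eqF.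
have Qn : Q (M - m) (M - x3) a != 0 by rewrite gt_eqF.
split=> [/eqP|h]; first by rewrite eqr_div// => /eqP <-.
by apply/eqP; rewrite eqr_div// h.
Qed.

(** Intermediate value theorem for the polynomial left after clearing denominators: it equals
    [x1 ^+ 2 - x2 <= 0] at 0 and is nonnegative at the right endpoint, where [cubic_num]
    vanishes. *)
Lemma cubic_root_exists (x1 x2 x3 m M : R) : m < M ->
  x1 ^+ 2 <= x2 -> m < x3 -> x3 <= M -> 0 < x2 ->
  exists a, solves_cubic x1 x2 x3 m M a.
Proof.
move=> mM x12 mx xM x20.
have D0 : 0 < M - m by lra.
pose c x : {poly R} := x%:P.
pose p := c (x1 ^+ 2) * ((1 - c 2 * 'X * c (M - m)) ^+ 2 * (1 - c 4 * 'X * c (M - x3)))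
  - (1 - c 2 * 'X * c (M - x3)) ^+ 2 * (1 - c 4 * 'X * c (M - m)) * c x2.
have pE a : p.[a] = x1 ^+ 2 * Q (M - m) (M - x3) a - P (M - m) (M - x3) a * x2.
  by rewrite /p /c /cubic_num /cubic_den !hornerE.
have b0 : 0 <= (4 * (M - m))^-1 by rewrite invr_ge0 mulr_ge0// ltW.
have p0 : p.[0] <= 0 by rewrite pE /cubic_num /cubic_den; lra.
have p1 : 0 <= p.[(4 * (M - m))^-1].
  have uD : M - x3 < M - m by lra.
  have u0 : 0 <= M - x3 by lra.
  have [_ _ /ltW s0] := cubic_denom_gt0 u0 uD b0 (lexx _).
  rewrite pE; have -> : P (M - m) (M - x3) (4 * (M - m))^-1 = 0.
    by rewrite /cubic_num; field; rewrite gt_eqF.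
  by rewrite mul0r subr0 /cubic_den mulr_ge0 ?sqr_ge0// mulr_ge0 ?sqr_ge0.
have [a ab /rootP] := @poly_ivt _ p _ _ b0 (introT andP (conj p0 p1)).
rewrite pE => /eqP; rewrite subr_eq0 => /eqP h.
exists a; split => //.
by apply/solves_cubicE.
Qed.

Lemma cubic_root_unique (x1 x2 x3 m M a b : R) :
  m < x3 -> x3 <= M -> 0 < x2 ->
  solves_cubic x1 x2 x3 m M a -> solves_cubic x1 x2 x3 m M b -> a = b.
Proof.
move=> mx xM x20.
wlog : a b / a <= b.
  by move=> h; case: (leP a b) => [|/ltW] ab sa sb; [|apply/esym]; exact: h.
rewrite le_eqVlt => /predU1P[//|ab] [/[dup] aM /andP[a0 _]].
move=> /(solves_cubicE _ mx xM x20 aM) ha [/[dup] bM /andP[b0 bM']].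
move=> /(solves_cubicE _ mx xM x20 bM) hb.
have uD : M - x3 < M - m by lra.
have u0 : 0 <= M - x3 by lra.
have [bD _ _] := cubic_denom_gt0 u0 uD b0 bM'.
have := cubic_ratio_decreasing u0 uD a0 ab bD.
rewrite -(ltr_pM2r x20) [ltRHS]mulrAC ha [ltLHS]mulrAC hb mulrAC.
by rewrite ltxx.
Qed.

End cubic.

(** Eliminating [x1 ^+ 2] by means of the cubic turns the majorant into the closed formula. The root
    [a = 0], where [(2 * a)^-1] is meaningless, is reached by a limit in [majorant_small]. *)
Lemma majorant_cubic (R : realType) (a m M x1 x2 x3 : R) :
  m < x3 -> x3 <= M -> 0 < x2 -> 0 < a ->
  solves_cubic x1 x2 x3 m M a ->
  majorant a m M x1 x2 x3 = (x3 - m) * x2 /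
    ((1 - 2 * a * (M - m)) ^+ 2 * (1 - 4 * a * (M - x3))) + m * x2.
Proof.
move=> mx xM x20 a0 [/andP[_ aM] h].
have uD : M - x3 < M - m by lra.
have u0 : 0 <= M - x3 by lra.
have [D4 t0 s0] := cubic_denom_gt0 u0 uD (ltW a0) aM.
have s20 : 0 < 1 - 2 * a * (M - x3) by nra.
have -> : x3 - m = (M - m) - (M - x3) by lra.
have x2n : x2 != 0 by rewrite gt_eqF.
rewrite /majorant -[x1 ^+ 2](divfK x2n) h.
by field; rewrite !gt_eqF.
Qed.

(** * Values reached by finite dyadic splittings *)

(* reach x1 x2 z v: for m = 0 and M = 1, a finite tree of dyadic splittings with
   constant functions at its leaves produces the averages (x1, x2, z) and the
   Carleson sum v; in reach_node, d is the normalized alpha at the root. *)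
Inductive reach (R : realType) : R -> R -> R -> R -> Prop :=
| reach_leaf c d : 0 <= d <= 1 -> reach c (c ^+ 2) d (c ^+ 2 * d)
| reach_node x1 x2 z v y1 y2 w u d :
    reach x1 x2 z v -> reach y1 y2 w u -> 0 <= d -> (z + w) / 2 + d <= 1 ->
    reach ((x1 + y1) / 2) ((x2 + y2) / 2) ((z + w) / 2 + d)
      ((v + u) / 2 + ((x1 + y1) / 2) ^+ 2 * d).

Section reach_theory.
Variable R : realType.
Implicit Types x y z v w u d t : R.

Lemma reach_eq x1 x2 z v y1 y2 w u : reach x1 x2 z v ->
  x1 = y1 -> x2 = y2 -> z = w -> v = u -> reach y1 y2 w u.
Proof. by move=> h <- <- <- <-. Qed.

Lemma reach_dom x1 x2 z v : reach x1 x2 z v ->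
  [/\ x1 ^+ 2 <= x2, 0 <= z <= 1 & 0 <= v].
Proof.
elim=> {x1 x2 z v} [c d /andP[d0 d1]|x1 x2 z v y1 y2 w u d _].
  by split; rewrite ?d0 ?d1// mulr_ge0 ?sqr_ge0.
move=> [hx /andP[z0 z1] v0] _ [hy /andP[w0 w1] u0] d0 hd.
split.
- by have := sqr_ge0 (x1 - y1); nra.
- by apply/andP; split => //; lra.
- by rewrite addr_ge0 ?divr_ge0 ?addr_ge0// mulr_ge0 ?sqr_ge0.
Qed.

(** Bellman induction with the majorant at the endpoint [a = 1 / 4], whose negative term is then
    dropped. It makes the suprema of reached values finite. *)
Lemma reach_le x1 x2 z v : reach x1 x2 z v -> v <= 4 * x2.
Proof.
move=> h; have [_ /andP[z0 z1] _] := reach_dom h.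
have q0 : (0 : R) < 1 / 4 by lra.
have q1 : 1 / 4 <= (4 * (1 - 0))^-1 :> R by rewrite subr0 mulr1 mul1r.
have : v <= majorant (1 / 4) 0 1 x1 x2 z.
  elim: h {z0 z1} => {x1 x2 z v} [c d /andP[d0 d1]|
      x1 x2 z v y1 y2 w u d hx ihx hy ihy d0 hd].
    by apply: majorant_ge.
  have [_ /andP[z0 z1] _] := reach_dom hx.
  have [_ /andP[w0 w1] _] := reach_dom hy.
  apply: le_trans (majorant_main x1 x2 y1 y2 ltr01 q0 q1 z0 w0 d0 hd).
  by rewrite lerD2r; lra.
move/le_trans; apply; rewrite /majorant mul0r add0r subr0 mulr1.
have : 0 <= x1 ^+ 2 / (1 - 2 * (1 / 4) * (1 - z)).
  by rewrite divr_ge0 ?sqr_ge0//; lra.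
set q := _ / _ => q_ge0.
have -> : x2 / (1 - 2 * (1 / 4)) = 2 * x2 by field.
have -> : (2 * (1 / 4))^-1 = 2 :> R by field.
lra.
Qed.

Lemma reach_scale t x1 x2 z v : reach x1 x2 z v ->
  reach (t * x1) (t ^+ 2 * x2) z (t ^+ 2 * v).
Proof.
elim=> {x1 x2 z v} [c d d01|x1 x2 z v y1 y2 w u d _ hx _ hy d0 hd].
  by apply: reach_eq (reach_leaf (t * c) d01) _ _ _ _ => //; ring.
by apply: reach_eq (reach_node hx hy d0 hd) _ _ _ _ => //; field.
Qed.

Lemma reach_mid x1 x2 z v y1 y2 w u : reach x1 x2 z v -> reach y1 y2 w u ->
  reach ((x1 + y1) / 2) ((x2 + y2) / 2) ((z + w) / 2) ((v + u) / 2).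
Proof.
move=> hx hy; have [_ /andP[z0 z1] _] := reach_dom hx.
have [_ /andP[w0 w1] _] := reach_dom hy.
have h : (z + w) / 2 + 0 <= 1 by lra.
by apply: reach_eq (reach_node hx hy (lexx 0) h) _ _ _ _ => //; field.
Qed.

(** Repeated halving yields all dyadic weights: [j / 2 ^ k.+1] is the midpoint of [j / 2 ^ k] and 0,
    or of [(j - 2 ^ k) / 2 ^ k] and 1. *)
Lemma reach_dyadic_conv x1 x2 z v y1 y2 w u (k j : nat) :
  reach x1 x2 z v -> reach y1 y2 w u -> (j <= 2 ^ k)%N ->
  let t := j%:R / 2 ^+ k in
  reach (t * x1 + (1 - t) * y1) (t * x2 + (1 - t) * y2)
    (t * z + (1 - t) * w) (t * v + (1 - t) * u).
Proof.
move=> hx hy; elim: k j => [|k ih] j /=.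
  rewrite expn0 expr0 divr1; case: j => [|[|//]] _.
    by apply: reach_eq hy _ _ _ _; ring.
  by apply: reach_eq hx _ _ _ _; ring.
move=> jk; have [jk'|jk'] := leqP j (2 ^ k).
  have e : j%:R / 2 ^+ k.+1 = j%:R / 2 ^+ k / 2 :> R.
    by rewrite exprSr invfM mulrA.
  rewrite e; set t := j%:R / _; have := ih _ jk'; rewrite -/t => h.
  by apply: reach_eq (reach_mid h hy) _ _ _ _; field.
have jk2 : (j - 2 ^ k <= 2 ^ k)%N by rewrite leq_subLR addnn -mul2n -expnS.
have e : j%:R / 2 ^+ k.+1 = ((j - 2 ^ k)%:R / 2 ^+ k + 1) / 2 :> R.
  rewrite natrB ?(ltnW jk')// natrX exprS.
  by field; rewrite expf_neq0// pnatr_eq0.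
rewrite e; set t := (j - 2 ^ k)%:R / _; have := ih _ jk2; rewrite -/t => h.
by apply: reach_eq (reach_mid h hx) _ _ _ _; field.
Qed.

(** Two constant leaves [x1 + s] and [x1 - s] suffice. This supplies filler points, of whose value
    only nonnegativity is used. *)
Lemma reach_any x1 x2 z : x1 ^+ 2 <= x2 -> 0 <= z <= 1 ->
  exists v, reach x1 x2 z v.
Proof.
move=> hx hz; set s := Num.sqrt (x2 - x1 ^+ 2).
have hs : s ^+ 2 = x2 - x1 ^+ 2 by rewrite sqr_sqrtr// subr_ge0.
eexists; apply: reach_eq (reach_mid (reach_leaf (x1 + s) hz)
   (reach_leaf (x1 - s) hz)) _ _ _ _; last by [].
- by field.
- by rewrite !sqrrD !sqrrN hs; field.
- by field.
Qed.

Lemma exp_half_small (e : R) : 0 < e -> exists k : nat, (2 ^+ k)^-1 < e.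
Proof.
move=> e0; exists (Num.truncn e^-1).+1.
rewrite invf_plt ?posrE ?exprn_gt0//.
apply: lt_le_trans (_ : (Num.truncn e^-1).+1%:R <= _).
  by rewrite truncnS_gt.
by rewrite -natrX ler_nat ltnW// ltn_expl.
Qed.

(** Only the lower half of being a supremum: reached values may also exceed [b]. *)
Definition reach_sup x1 x2 z b :=
  forall e, 0 < e -> exists2 v, reach x1 x2 z v & b - e < v.

(** The estimate on the top face, with [t] for [2 * a]; equality in the last hypothesis is the
    extremal ratio [r]. [K] is the constant of the recursion in [d]. *)
Lemma reach_top t r : 0 <= t -> t < 1 / 2 -> (1 - t) ^+ 2 <= r * (1 - 2 * t) ->
  reach_sup 1 r 1 (1 - 2 * t)^-1.
Proof.
move=> t0 t2 hr.
have t21 : 0 < 1 - 2 * t by lra.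
have r1 : 1 <= r.
  rewrite -(ler_pM2r t21) mul1r; apply: le_trans hr.
  by have := sqr_ge0 t; lra.
pose S := [set v | reach 1 r 1 v].
have S0 : S !=set0.
  by have [||v hv] := @reach_any 1 r 1; rewrite ?expr1n ?ler01 ?lexx//; exists v.
have hS : has_sup S.
  by split => //; exists (4 * r) => v; exact: reach_le.
set K := sup S.
have K4 : K <= 4 * r by apply: ge_sup => // v; exact: reach_le.
have K0 : 0 <= K.
  have [v hv] := S0; apply: (@le_trans _ _ v); first by case: (reach_dom hv).
  by apply: ub_le_sup => //; case: hS.
have step k (d := (2 ^+ k)^-1) : d + (1 - d) * (1 + t * d) ^+ 2 * K <= K.
  have d0 : 0 < d by rewrite invr_gt0 exprn_gt0.
  have d1 : d <= 1 by rewrite invf_le1 ?exprn_gt0// exprn_ege1// ler1n.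
  have td0 : 0 <= t * d by rewrite mulr_ge0// ltW.
  (* This point is forced: taken with weight [d] next to the top point scaled by [1 + t * d], it
     must restore the averages [1] and [r]. *)
  have [u hu] : exists u, reach (1 - t + t * d)
      (r * (1 - 2 * t + d * (2 * t - t ^+ 2 + t ^+ 2 * d))) 0 u.
    apply: reach_any; last by rewrite lexx ler01.
    have h1 : 0 <= d * (2 * t - t ^+ 2 + t ^+ 2 * d).
      apply: mulr_ge0; first exact: ltW.
      by have := mulr_ge0 (sqr_ge0 t) (ltW d0); nra.
    have h2 : d * (2 * t - t ^+ 2 + t ^+ 2 * d) <=
        r * (d * (2 * t - t ^+ 2 + t ^+ 2 * d)) by rewrite ler_peMl.
    rewrite mulrDr; apply: le_trans (lerD hr h2).
    have := mulr_ge0 (sqr_ge0 t) (ltW d0).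
    have -> : (1 - t + t * d) ^+ 2 =
      (1 - t) ^+ 2 + d * (2 * t - 2 * t ^+ 2 + t ^+ 2 * d) by ring.
    by move=> h3; rewrite lerD2l ler_pM2l//; have := sqr_ge0 t; lra.
  have [_ _ u0] := reach_dom hu.
  have v_le v : S v -> d + (1 - d) * (1 + t * d) ^+ 2 * v <= K.
    move=> Sv; apply: (@le_trans _ _ (d + ((1 - d) * (1 + t * d) ^+ 2 * v + d * u))).
      by rewrite lerD2l lerDl mulr_ge0// ltW.
    apply: ub_le_sup; first by case: hS.
    have jk : ((2 ^ k).-1 <= 2 ^ k)%N by exact: leq_pred.
    have e1 : (2 ^ k).-1%:R / 2 ^+ k = 1 - d.
      rewrite -subn1 natrB ?expn_gt0// natrX /d.
      by field; rewrite expf_neq0// pnatr_eq0.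
    (* The mixture has third coordinate [1 - d]. Using it for both halves leaves exactly [d] for the
       coefficient at the root, which collects [1 ^+ 2 * d]. *)
    have := reach_dyadic_conv (reach_scale (1 + t * d) Sv) hu jk.
    rewrite e1 => h; have h1 : ((1 - d) * 1 + (1 - (1 - d)) * 0 +
        ((1 - d) * 1 + (1 - (1 - d)) * 0)) / 2 + d <= 1 by lra.
    by apply: reach_eq (reach_node h h (ltW d0) h1) _ _ _ _; field.
  (* For [k = 0] the weight [1 - d] vanishes and cannot be divided by; the claim is then just
     [1 <= K]. *)
  have [d1'|d1'] := eqVneq d 1.
    have [v Sv] := S0; have := v_le v Sv.
    by rewrite d1' subrr !mul0r.
  have c0 : 0 < (1 - d) * (1 + t * d) ^+ 2.
    apply: mulr_gt0; first by rewrite subr_gt0 lt_neqAle d1'.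
    by rewrite exprn_gt0// ltr_wpDr.
  have : K <= (K - d) / ((1 - d) * (1 + t * d) ^+ 2).
    apply: ge_sup => // v /v_le hv.
    by rewrite ler_pdivlMr// lerBrDl mulrC.
  by rewrite ler_pdivlMr// lerBrDl mulrC.
have K1 : 1 <= K * (1 - 2 * t).
  rewrite leNgt; apply/negP => hK.
  (* Divided by [d], the recursion bounds the defect [1 - K * (1 - 2 * t)] by
     [d * (K * (2 * t - t ^+ 2 + t ^+ 2 * d))], hence by [d * (8 * r + 1)]. A smaller [d]
     contradicts this. *)
  have e0 : 0 < (1 - K * (1 - 2 * t)) / (8 * r + 1).
    by rewrite divr_gt0 ?subr_gt0//; lra.
  have [k] := exp_half_small e0; set d := _^-1.
  have hd : d + (1 - d) * (1 + t * d) ^+ 2 * K <= K := step k.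
  have d0 : 0 < d by rewrite invr_gt0 exprn_gt0.
  have d1 : d <= 1 by rewrite invf_le1 ?exprn_gt0// exprn_ege1// ler1n.
  rewrite ltr_pdivlMr; last by lra.
  apply/negP; rewrite -leNgt.
  have : 1 <= K * (1 - 2 * t) + d * (K * (2 * t - t ^+ 2 + t ^+ 2 * d)).
    rewrite -(ler_pM2l d0) mulr1 -subr_ge0.
    rewrite -subr_ge0 in hd; move: hd; congr (0 <= _); ring.
  have : d * (K * (2 * t - t ^+ 2 + t ^+ 2 * d)) <= d * (8 * r + 1).
    rewrite ler_pM2l//.
    have h1 : 2 * t - t ^+ 2 + t ^+ 2 * d <= 1.
      by have := ler_piMr (sqr_ge0 t) d1; lra.
    by have := ler_wpM2l K0 h1; lra.
  lra.
move=> e e0.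
have [v Sv hv] := sup_adherent e0 hS; exists v => //.
apply: le_lt_trans hv; rewrite lerD2r -/K.
by rewrite -[_^-1]mul1r ler_pdivrMr.
Qed.

End reach_theory.

(** * Near-optimal values along the extremal lines *)

Section reach_sup.
Variable R : realType.
Implicit Types x y z v w u d t a b c e : R.

Lemma reach_sup_scale c x1 x2 z b :
  reach_sup x1 x2 z b -> reach_sup (c * x1) (c ^+ 2 * x2) z (c ^+ 2 * b).
Proof.
move=> hb e e0.
(* The summand 1 allows for [c = 0]. *)
have c1 : 0 < c ^+ 2 + 1 by rewrite ltr_wpDl ?sqr_ge0.
have [v hv bv] := hb (e / (c ^+ 2 + 1)) (divr_gt0 e0 c1).
exists (c ^+ 2 * v); first exact: reach_scale.
have h1 : c ^+ 2 * (b - e / (c ^+ 2 + 1)) <= c ^+ 2 * v.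
  by rewrite ler_wpM2l ?sqr_ge0// ltW.
apply: lt_le_trans h1; rewrite mulrBr ltrD2l ltrN2 mulrA ltr_pdivrMr//.
by rewrite mulrC ltr_pM2l// ltrDl.
Qed.

Lemma reach_sup_mid x1 x2 z b y1 y2 w c :
  reach_sup x1 x2 z b -> reach_sup y1 y2 w c ->
  reach_sup ((x1 + y1) / 2) ((x2 + y2) / 2) ((z + w) / 2) ((b + c) / 2).
Proof.
move=> hb hc e e0.
have [v hv bv] := hb e e0; have [u hu cu] := hc e e0.
by exists ((v + u) / 2); [exact: reach_mid | lra].
Qed.

(** The point lies on the segment from [(c, r c^2, 1)], taken with weight [z], to [(y, y^2, 0)] with
    [y = c (1 - 2 a)]. Only the top end contributes to the value. *)
Lemma reach_sup_line a c z : 0 <= a -> a < 1 / 4 -> 0 < z -> z <= 1 ->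
  reach_sup (c * (1 - 2 * a * (1 - z)))
    (c ^+ 2 * (1 - 2 * a) ^+ 2 * (1 - 4 * a * (1 - z)) / (1 - 4 * a))
    z (z * c ^+ 2 / (1 - 4 * a)).
Proof.
move=> a0 a4 z0 z1.
have s0 : 0 < 1 - 4 * a by lra.
set r := (1 - 2 * a) ^+ 2 / (1 - 4 * a).
have r1 : 1 <= r by rewrite ler_pdivlMr// mul1r; have := sqr_ge0 a; nra.
have top : reach_sup c (c ^+ 2 * r) 1 (c ^+ 2 / (1 - 4 * a)).
  have -> : c = c * 1 by rewrite mulr1.
  have -> : (c * 1) ^+ 2 = c ^+ 2 by rewrite mulr1.
  apply: reach_sup_scale.
  have e4 : 1 - 4 * a = 1 - 2 * (2 * a) by ring.
  rewrite e4; apply: reach_top; [lra|lra|].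
  by rewrite /r -e4 divfK// gt_eqF.
have [->|z1'] := eqVneq z 1.
  rewrite !subrr !mulr0 !subr0 !mulr1 mul1r.
  by move: top; rewrite /r mulrA.
have {}z1' : z < 1 by rewrite lt_neqAle z1'.
move=> e e0.
set V := c ^+ 2 / (1 - 4 * a).
have V0 : 0 <= V by rewrite divr_ge0 ?sqr_ge0// ltW.
have e20 : 0 < e / 2 by lra.
have [k hk] : exists k : nat, (2 ^+ k)^-1 < e / 2 / (V + 1).
  by apply: exp_half_small; rewrite divr_gt0// ltr_wpDl.
have k0 : 0 < (2 : R) ^+ k by rewrite exprn_gt0.
pose j := Num.truncn (z * 2 ^+ k); pose t := j%:R / 2 ^+ k : R.
have zk0 : 0 <= z * 2 ^+ k by rewrite mulr_ge0// ltW.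
have tz : t <= z by rewrite ler_pdivrMr// truncn_le.
have zt : z < t + (2 ^+ k)^-1.
  have -> : t + (2 ^+ k)^-1 = j.+1%:R / 2 ^+ k by rewrite -[j.+1%:R]natr1 mulrDl mul1r.
  by rewrite ltr_pdivlMr// truncnS_gt.
have t0 : 0 <= t by rewrite divr_ge0// ltW.
have t1 : 0 < 1 - t by rewrite subr_gt0; exact: le_lt_trans z1'.
have jk : (j <= 2 ^ k)%N.
  rewrite -(ler_nat R) natrX -[leRHS]mul1r -ler_pdivrMr//.
  exact: le_trans tz z1.
have [v hv Vv] := top _ e20.
(* Only dyadic weights are available, so the top end gets the weight [t <= z]. The other end is
   moved up the same segment to height [s], which restores the target point; its value is dropped,
   at a cost of about [(z - t) * V]. *)
pose s := (z - t) / (1 - t).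
have s01 : 0 <= s <= 1.
  apply/andP; split; first by rewrite divr_ge0 ?subr_ge0// -subr_ge0 ltW.
  by rewrite ler_pdivrMr// mul1r lerD2r.
have [u hu] : exists u, reach ((1 - s) * (c * (1 - 2 * a)) + s * c)
    ((1 - s) * (c * (1 - 2 * a)) ^+ 2 + s * (c ^+ 2 * r)) s u.
  apply: reach_any => //.
  have h1 : s * c ^+ 2 <= s * (c ^+ 2 * r).
    by case/andP: s01 => *; rewrite ler_wpM2l// ler_peMr// sqr_ge0.
  apply: (@le_trans _ _ ((1 - s) * (c * (1 - 2 * a)) ^+ 2 + s * c ^+ 2)); last first.
    by rewrite lerD2l.
  rewrite -subr_ge0.
  have -> : (1 - s) * (c * (1 - 2 * a)) ^+ 2 + s * c ^+ 2 -
     ((1 - s) * (c * (1 - 2 * a)) + s * c) ^+ 2 =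
     s * (1 - s) * (2 * a * c) ^+ 2 by ring.
  by case/andP: s01 => *; rewrite mulr_ge0 ?sqr_ge0// mulr_ge0// subr_ge0.
have [_ _ u0] := reach_dom hu.
exists (t * v + (1 - t) * u).
  apply: reach_eq (reach_dyadic_conv hv hu jk) _ _ _ _; rewrite -/t //.
  - by rewrite /s; field; rewrite gt_eqF.
  - by rewrite /s /r; field; rewrite !gt_eqF.
  - by rewrite /s; field; rewrite gt_eqF.
apply: (@lt_le_trans _ _ (t * v)); last by rewrite lerDl mulr_ge0// ltW.
have h1 : t * (V - e / 2) <= t * v by rewrite ler_wpM2l// ltW.
have h2 : t * (e / 2) <= e / 2 by rewrite ler_piMl ?(ltW e20)//; lra.
have h3 : (z - t) * V < e / 2.
  apply: (@le_lt_trans _ _ ((2 ^+ k)^-1 * (V + 1))).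
    by rewrite ler_pM ?subr_ge0// ?lerDl//; lra.
  by rewrite -ltr_pdivlMr// ltr_wpDl.
have -> : z * c ^+ 2 / (1 - 4 * a) = z * V by rewrite /V mulrA.
lra.
Qed.

(** A point satisfying the cubic with [a < 1 / 4] lies on the extremal line whose top end has first
    coordinate [c = x1 / (1 - 2 * a * (1 - z))]. *)
Lemma reach_sup_lt_quarter a x1 x2 z : 0 <= a -> a < 1 / 4 -> 0 < z -> z <= 1 ->
  (1 - 2 * a * (1 - z)) ^+ 2 * (1 - 4 * a) * x2 =
    x1 ^+ 2 * ((1 - 2 * a) ^+ 2 * (1 - 4 * a * (1 - z))) ->
  reach_sup x1 x2 z (z * x2 / ((1 - 2 * a) ^+ 2 * (1 - 4 * a * (1 - z)))).
Proof.
move=> a0 a4 z0 z1 h.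
have p0 : 0 < 1 - 4 * a by lra.
have p1 : 0 < 1 - 2 * a by lra.
have p2 : 0 < 1 - 4 * a * (1 - z) by nra.
have p3 : 0 < 1 - 2 * a * (1 - z) by nra.
have := @reach_sup_line a (x1 / (1 - 2 * a * (1 - z))) z a0 a4 z0 z1.
have -> : x2 = x1 ^+ 2 * ((1 - 2 * a) ^+ 2 * (1 - 4 * a * (1 - z))) /
    ((1 - 2 * a * (1 - z)) ^+ 2 * (1 - 4 * a)).
  by rewrite -h mulrC mulKf// mulf_neq0 ?expf_neq0// gt_eqF.
rewrite divfK ?gt_eqF//.
have n0 := gt_eqF p0; have n1 := gt_eqF p1; have n2 := gt_eqF p2.
have n3 := gt_eqF p3.
set X2 := (X in reach_sup _ X _ _ -> _); set B := (X in reach_sup _ _ _ X -> _).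
set X2' := (X in _ -> reach_sup _ X _ _); set B' := (X in _ -> reach_sup _ _ _ X).
have -> : X2 = X2' by rewrite /X2 /X2'; field; rewrite ?n0 ?n1 ?n2 ?n3.
by have -> : B = B' by rewrite /B /B'; field; rewrite ?n0 ?n1 ?n2 ?n3.
Qed.

(** The degenerate root [a = 1 / 4], approached through [a = 1 / 4 - h]: the points with first
    coordinates [c] and [- c] share [x2] and the value, and their midpoint has [x1 = 0]. *)
Lemma reach_sup_x1_eq0 x2 z : 0 <= x2 -> 0 < z -> z <= 1 ->
  reach_sup 0 x2 z (4 * x2).
Proof.
move=> x20 z0 z1 e e0.
(* For [h <= 1 / 8] one has [4 * X <= z + 28 * h], so [z * x2 / X] is at least
   [4 * x2 * (1 - 28 * h / z)]; the second bound on [h] makes this loss at most [e / 2]. *)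
pose h := Num.min (1 / 8) (e / 2 * z / (4 * 28 * x2 + 1)).
have h0 : 0 < h by rewrite lt_min !divr_gt0 ?mulr_gt0//; lra.
have h8 : h <= 1 / 8 by rewrite ge_min lexx.
have he : 4 * x2 * (28 * h) <= e / 2 * z.
  have : h * (4 * 28 * x2 + 1) <= e / 2 * z.
    by rewrite -ler_pdivlMr ?ge_min ?lexx ?orbT//; lra.
  by apply: le_trans; lra.
pose a := 1 / 4 - h.
have a0 : 0 <= a by rewrite /a; lra.
have a4 : a < 1 / 4 by rewrite /a; lra.
have p0 : 0 < 1 - 4 * a by lra.
have p1 : 0 < 1 - 2 * a by lra.
have p2 : 0 < 1 - 4 * a * (1 - z) by nra.
have p3 : 0 < 1 - 2 * a * (1 - z) by nra.
have n1 := gt_eqF p1; have n2 := gt_eqF p2.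
pose X := (1 - 2 * a) ^+ 2 * (1 - 4 * a * (1 - z)).
have X0 : 0 < X by rewrite mulr_gt0// exprn_gt0.
pose c := Num.sqrt (x2 * ((1 - 2 * a * (1 - z)) ^+ 2 * (1 - 4 * a)) / X).
have c2 : c ^+ 2 = x2 * ((1 - 2 * a * (1 - z)) ^+ 2 * (1 - 4 * a)) / X.
  by rewrite sqr_sqrtr// divr_ge0 ?(ltW X0)// !mulr_ge0 ?sqr_ge0// ltW.
have hc : (1 - 2 * a * (1 - z)) ^+ 2 * (1 - 4 * a) * x2 = c ^+ 2 * X.
  by rewrite c2 divfK ?gt_eqF// mulrC.
have h1 := reach_sup_lt_quarter a0 a4 z0 z1 hc.
rewrite -[c ^+ 2]sqrrN in hc; have h2 := reach_sup_lt_quarter a0 a4 z0 z1 hc.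
have := reach_sup_mid h1 h2; rewrite addrN mul0r -/X.
have half w : (w + w) / 2 = w by field.
rewrite !half => /(_ (e / 2)) [|v hv bv]; first by lra.
exists v => //; apply: le_lt_trans bv.
suff : 4 * x2 * (1 - 28 * h / z) <= z * x2 / X.
  have : 4 * x2 * (28 * h) / z <= e / 2 by rewrite ler_pdivrMr.
  rewrite mulrBr mulr1 -!mulrA; lra.
rewrite ler_pdivlMr// -(ler_pM2l z0).
have -> : z * (4 * x2 * (1 - 28 * h / z) * X) = x2 * ((z - 28 * h) * (4 * X)).
  by field; rewrite gt_eqF.
have -> : z * (z * x2) = x2 * z ^+ 2 by ring.
rewrite ler_wpM2l//.
have XE : 4 * X = (1 + 4 * h) ^+ 2 * (z + 4 * h * (1 - z)).
  by rewrite /X /a; field.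
have X4 : 4 * X <= z + 28 * h.
  rewrite XE.
  have : (1 + 4 * h) ^+ 2 <= 1 + 10 * h by nra.
  move=> q; apply: (@le_trans _ _ ((1 + 10 * h) * (z + 4 * h * (1 - z)))).
    by rewrite ler_wpM2r//; nra.
  have : h * z <= h by rewrite ler_piMr// ltW.
  have : h * h <= h * (1 / 8) by rewrite ler_wpM2l// ltW.
  have : 0 <= h * h * z by rewrite !mulr_ge0// ltW.
  by lra.
have [zh|zh] := leP (z - 28 * h) 0.
  apply: (@le_trans _ _ 0); last exact: sqr_ge0.
  by rewrite mulr_le0_ge0// mulr_ge0// ltW.
apply: (@le_trans _ _ ((z - 28 * h) * (z + 28 * h))).
  by rewrite ler_wpM2l// ltW.
by have := sqr_ge0 h; nra.
Qed.

(** Rescaling to the constants 0 and 1 replaces [a] by [a * (M - m)]. When this equals [1 / 4], the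
    numerator of the cubic vanishes and forces [x1 = 0]. *)
Lemma reach_sup_cubic m M x1 x2 x3 a : m < x3 -> x3 <= M -> 0 < x2 ->
  solves_cubic x1 x2 x3 m M a ->
  reach_sup x1 x2 ((x3 - m) / (M - m)) ((x3 - m) / (M - m) * x2 /
    ((1 - 2 * a * (M - m)) ^+ 2 * (1 - 4 * a * (M - x3)))).
Proof.
move=> mx xM x20 [/[dup] a4 /andP[a0 aM]] /(solves_cubicE _ mx xM x20 a4).
rewrite /cubic_num /cubic_den => h.
have D0 : 0 < M - m by lra.
set z := (x3 - m) / (M - m).
have z0 : 0 < z by rewrite divr_gt0// subr_gt0.
have z1 : z <= 1 by rewrite ler_pdivrMr// mul1r lerD2r.
have zE : M - x3 = (M - m) * (1 - z) by rewrite /z; field; rewrite gt_eqF.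
move: h; rewrite zE; set D := M - m in D0 aM *.
have e4 : 4 * a * (D * (1 - z)) = 4 * (a * D) * (1 - z) by ring.
have e2 : 2 * a * (D * (1 - z)) = 2 * (a * D) * (1 - z) by ring.
rewrite e4 e2 -!(mulrA _ a D) => h.
have : a * D <= 1 / 4.
  move: aM; rewrite -(ler_pM2r D0) => /le_trans; apply.
  by rewrite invfM -mulrA mulVf ?gt_eqF//; lra.
rewrite le_eqVlt => /predU1P[a4'|]; last first.
  by move=> a4'; apply: reach_sup_lt_quarter => //; rewrite mulr_ge0// ltW.
move: h; rewrite a4'.
have -> : 1 - 4 * (1 / 4) = 0 :> R by field.
have -> : 1 - 4 * (1 / 4) * (1 - z) = z by field.
rewrite mulr0 mul0r => /esym/eqP; rewrite mulf_eq0 sqrf_eq0 => /orP[/eqP ->|].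
  have -> : z * x2 / ((1 - 2 * (1 / 4)) ^+ 2 * z) = 4 * x2.
    by field; rewrite gt_eqF.
  exact: reach_sup_x1_eq0 (ltW x20) z0 z1.
by rewrite gt_eqF// mulr_gt0// exprn_gt0//; lra.
Qed.

End reach_sup.

(** * Dyadic intervals *)

Variant nontrivial_itv (R : realType) : interval R -> Prop :=
| Nontrivial_itv bl l br r of l < r :
    nontrivial_itv (Interval (BSide bl l) (BSide br r)).

Section dyadic_intervals.
Variable R : realType.
Implicit Types I J K : interval R.

Lemma left_halfE bl (l : R) br r :
  left_half (Interval (BSide bl l) (BSide br r)) =
  Interval (BSide bl l) (BLeft ((l + r) / 2)).
Proof. by rewrite /left_half /=; congr (Interval _ (BLeft _)); field. Qed.

Lemma right_halfE bl (l : R) br r :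
  right_half (Interval (BSide bl l) (BSide br r)) =
  Interval (BLeft ((l + r) / 2)) (BSide br r).
Proof. by rewrite /right_half /=; congr (Interval (BLeft _) _); field. Qed.

Lemma nontrivial_left_half J : nontrivial_itv J -> nontrivial_itv (left_half J).
Proof. by case=> bl l br r lr; rewrite left_halfE; split; lra. Qed.

Lemma nontrivial_right_half J :
  nontrivial_itv J -> nontrivial_itv (right_half J).
Proof. by case=> bl l br r lr; rewrite right_halfE; split; lra. Qed.

Lemma nontrivial_dyadic I J :
  nontrivial_itv I -> dyadic I J -> nontrivial_itv J.
Proof.
move=> hI; elim=> {J} [//|J _|J _].
  exact: nontrivial_left_half.
exact: nontrivial_right_half.
Qed.

Lemma lebesgue_measure_itv_bnd bl (l : R) br r : l < r ->
  lebesgue_measure [set` Interval (BSide bl l) (BSide br r)] = (r - l)%:E.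
Proof. by move=> lr; rewrite lebesgue_measure_itv /= lte_fin lr. Qed.

Lemma len_itv bl (l : R) br r : l < r ->
  len (Interval (BSide bl l) (BSide br r)) = r - l.
Proof. by move=> lr; rewrite /len lebesgue_measure_itv_bnd. Qed.

Lemma lebesgue_measure_len J : nontrivial_itv J ->
  lebesgue_measure [set` J] = (len J)%:E.
Proof. by case=> *; rewrite len_itv// lebesgue_measure_itv_bnd. Qed.

Lemma len_gt0 J : nontrivial_itv J -> 0 < len J.
Proof. by case=> *; rewrite len_itv// subr_gt0. Qed.

Lemma len_left_half J : nontrivial_itv J -> len (left_half J) = len J / 2.
Proof. by case=> bl l br r lr; rewrite left_halfE !len_itv; lra. Qed.

Lemma len_right_half J : nontrivial_itv J -> len (right_half J) = len J / 2.
Proof. by case=> bl l br r lr; rewrite right_halfE !len_itv; lra. Qed.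

Lemma halves_setU J : nontrivial_itv J ->
  [set` J] = [set` left_half J] `|` [set` right_half J].
Proof.
case=> bl l br r lr; rewrite left_halfE right_halfE -itv_bndbnd_setU//.
  by case: bl; rewrite bnd_simp; lra.
by case: br; rewrite bnd_simp; lra.
Qed.

Lemma halves_setI J : nontrivial_itv J ->
  [set` left_half J] `&` [set` right_half J] = set0.
Proof.
case=> bl l br r lr; rewrite left_halfE right_halfE; apply/seteqP; split => // x.
by case: bl br => -[] []; rewrite /= !in_itv/=; lra.
Qed.

Lemma left_half_sub J : nontrivial_itv J -> [set` left_half J] `<=` [set` J].
Proof. by move=> hJ; rewrite (halves_setU hJ); exact: subsetUl. Qed.

Lemma right_half_sub J : nontrivial_itv J -> [set` right_half J] `<=` [set` J].
Proof. by move=> hJ; rewrite (halves_setU hJ); exact: subsetUr. Qed.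

Lemma dyadic_sub I J : nontrivial_itv I -> dyadic I J -> [set` J] `<=` [set` I].
Proof.
move=> hI; elim=> {J} [//|J IJ|J IJ] /(subset_trans _); apply.
  by apply: left_half_sub; exact: nontrivial_dyadic IJ.
by apply: right_half_sub; exact: nontrivial_dyadic IJ.
Qed.

Lemma dyadic_trans I J K : dyadic I J -> dyadic J K -> dyadic I K.
Proof. by move=> IJ; elim=> {K} [//|K _|K _]; constructor. Qed.

Lemma dyadic_left_half I : dyadic I (left_half I).
Proof. exact/dyadic_left/dyadic_self. Qed.

Lemma dyadic_right_half I : dyadic I (right_half I).
Proof. exact/dyadic_right/dyadic_self. Qed.

Lemma dyadic_setU I : dyadic I =
  [set I] `|` (dyadic (left_half I) `|` dyadic (right_half I)).
Proof.
apply/seteqP; split => J.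
  elim=> {J} [|J _ [->|[IJ|IJ]]|J _ [->|[IJ|IJ]]]; first by left.
  - by right; left; exact: dyadic_self.
  - by right; left; exact: dyadic_left.
  - by right; right; exact: dyadic_left.
  - by right; right; exact: dyadic_self.
  - by right; left; exact: dyadic_right.
  - by right; right; exact: dyadic_right.
move=> [->|[]]; first exact: dyadic_self.
  exact: (dyadic_trans (dyadic_left_half I)).
exact: (dyadic_trans (dyadic_right_half I)).
Qed.

Lemma nontrivial_itv_neq0 J : nontrivial_itv J -> [set` J] !=set0.
Proof.
case=> bl l br r lr; exists ((l + r) / 2).
by rewrite /= in_itv; case: bl; case: br => /=; lra.
Qed.

Lemma dyadic_halves_disj I J : nontrivial_itv I ->
  dyadic (left_half I) J -> dyadic (right_half I) J -> False.
Proof.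
move=> hI lJ rJ.
have hl := nontrivial_left_half hI; have hr := nontrivial_right_half hI.
have [t Jt] := nontrivial_itv_neq0 (nontrivial_dyadic hl lJ).
have : ([set` left_half I] `&` [set` right_half I]) t.
  by split; [exact: dyadic_sub lJ _ Jt|exact: dyadic_sub rJ _ Jt].
by rewrite halves_setI.
Qed.

Lemma dyadic_len I J : nontrivial_itv I -> dyadic I J -> len J <= len I.
Proof.
move=> hI IJ; have hJ := nontrivial_dyadic hI IJ.
rewrite -lee_fin -!lebesgue_measure_len// le_measure ?inE//.
exact: dyadic_sub.
Qed.

Lemma not_dyadic_left_half I : nontrivial_itv I -> ~ dyadic (left_half I) I.
Proof.
move=> hI /(dyadic_len (nontrivial_left_half hI)).
by rewrite len_left_half//; have := len_gt0 hI; lra.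
Qed.

Lemma not_dyadic_right_half I : nontrivial_itv I -> ~ dyadic (right_half I) I.
Proof.
move=> hI /(dyadic_len (nontrivial_right_half hI)).
by rewrite len_right_half//; have := len_gt0 hI; lra.
Qed.

(** Generations 0 to [n - 1]. Generation [n] is left out because the Bellman induction accounts for
    it by an integral of averages. *)
Fixpoint dyadic_upto (n : nat) (I : interval R) : set (interval R) :=
  if n is n'.+1 then
    [set I] `|` (dyadic_upto n' (left_half I) `|` dyadic_upto n' (right_half I))
  else set0.

Lemma dyadic_upto_sub n I : dyadic_upto n I `<=` dyadic I.
Proof.
elim: n I => [|n ih] I //= J; rewrite dyadic_setU => -[->|[]]; first by left.
  by right; left; exact: ih.
by right; right; exact: ih.
Qed.

Lemma dyadic_uptoS n I : dyadic_upto n I `<=` dyadic_upto n.+1 I.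
Proof.
elim: n I => [|n ih] I //= J [->|[]]; first by left.
  by move/ih; right; left.
by move/ih; right; right.
Qed.

Lemma dyadic_upto_le n k I : (n <= k)%N -> dyadic_upto n I `<=` dyadic_upto k I.
Proof.
move=> /subnK <-; elim: (k - n)%N => [//|i ih]; rewrite addSn.
exact: subset_trans ih (@dyadic_uptoS _ _).
Qed.

Lemma dyadic_upto_halves n I J : dyadic_upto n I J ->
  dyadic_upto n.+1 I (left_half J) /\ dyadic_upto n.+1 I (right_half J).
Proof.
elim: n I => [//|n ih] I [->|[/ih|/ih]].
- by split; right; [left|right]; left.
- by move=> [l r]; split; right; left.
- by move=> [l r]; split; right; right.
Qed.

Lemma dyadic_exists_upto I J : dyadic I J -> exists n, dyadic_upto n I J.
Proof.
elim=> {J} [|J _ [n /dyadic_upto_halves[]]|J _ [n /dyadic_upto_halves[]]].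
- by exists 1%N; left.
- by exists n.+1.
- by exists n.+1.
Qed.

Lemma finite_dyadic_upto I (A : set (interval R)) :
  finite_set A -> A `<=` dyadic I -> exists n, A `<=` dyadic_upto n I.
Proof.
move=> /finite_seqP[s ->]; elim: s => [|J s ih] sI; first by exists 0%N.
have [|n hn] := ih; first by move=> K /= Ks; apply: sI; rewrite /= inE Ks orbT.
have [|k hk] := @dyadic_exists_upto I J; first by apply: sI; rewrite /= mem_head.
exists (maxn n k) => K /=; rewrite inE => /predU1P[->|].
  by apply: dyadic_upto_le hk; rewrite leq_maxr.
by move=> /hn; apply: dyadic_upto_le; rewrite leq_maxl.
Qed.

End dyadic_intervals.

(** * Sums over the dyadic lattice *)

Section dyadic_sums.
Local Open Scope ereal_scope.
Variable R : realType.
Implicit Types I J K : interval R.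

Lemma esum_setU (T : choiceType) (A B : set T) (f : T -> \bar R) :
  (forall i, A i -> 0 <= f i) -> (forall i, B i -> 0 <= f i) ->
  (forall i, A i -> B i -> False) ->
  \esum_(i in A `|` B) f i = \esum_(i in A) f i + \esum_(i in B) f i.
Proof.
move=> fA fB AB; rewrite (esumID A); last by move=> i [/fA|/fB].
by congr (_ + _); congr esum; apply/seteqP; split => i //=;
  [case|split => //; left|case=> -[]|split; [right|move=> /AB; apply]].
Qed.

Lemma esum_dyadic I (f : interval R -> \bar R) : nontrivial_itv I ->
  (forall J, dyadic I J -> 0 <= f J) ->
  \esum_(J in dyadic I) f J = f I +
    (\esum_(J in dyadic (left_half I)) f J +
     \esum_(J in dyadic (right_half I)) f J).
Proof.
move=> hI; rewrite dyadic_setU => f0; rewrite !esum_setU ?esum_set1//.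
- by apply: f0; left.
- by move=> J lJ; apply: f0; right; left.
- by move=> J lJ; apply: f0; right; right.
- by move=> J; exact: dyadic_halves_disj.
- by move=> J lJ; apply: f0; left.
- by move=> J lJ; apply: f0; right.
- by move=> J -> []; [exact: not_dyadic_left_half|exact: not_dyadic_right_half].
Qed.

Lemma esum_dyadic_upto n I (f : interval R -> \bar R) : nontrivial_itv I ->
  (forall J, dyadic I J -> 0 <= f J) ->
  \esum_(J in dyadic_upto n.+1 I) f J = f I +
    (\esum_(J in dyadic_upto n (left_half I)) f J +
     \esum_(J in dyadic_upto n (right_half I)) f J).
Proof.
move=> hI; rewrite dyadic_setU => f0 /=; rewrite !esum_setU ?esum_set1//.
- by apply: f0; left.
- by move=> J /dyadic_upto_sub lJ; apply: f0; right; left.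
- by move=> J /dyadic_upto_sub lJ; apply: f0; right; right.
- by move=> J /dyadic_upto_sub lJ /dyadic_upto_sub; exact: dyadic_halves_disj lJ.
- by move=> J lJ; apply: f0; left.
- by move=> J [] /dyadic_upto_sub lJ; apply: f0; right; [left|right].
- by move=> J -> [] /dyadic_upto_sub;
    [exact: not_dyadic_left_half|exact: not_dyadic_right_half].
Qed.

(** A finite set of dyadic intervals meets only finitely many generations, so truncations by depth
    exhaust the sum. *)
Lemma esum_dyadic_le I (f : interval R -> \bar R) b :
  (forall J, dyadic I J -> 0 <= f J) ->
  (forall n, \esum_(J in dyadic_upto n I) f J <= b) ->
  \esum_(J in dyadic I) f J <= b.
Proof.
move=> f0 fb; apply: ge_ereal_sup => _ [A [finA AI] <-].
have [n An] := finite_dyadic_upto finA AI.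
by apply: le_trans (fb n); apply: ereal_sup_ubound; exists A.
Qed.

End dyadic_sums.

(** * Domination by Lebesgue measure *)

Section domination.
Local Open Scope ereal_scope.
Variable R : realType.
Variable mu : {measure set (measurableTypeR R) -> \bar R}.
Notation leb := (@lebesgue_measure R).

Lemma measure_halves_setI (nu : {measure set (measurableTypeR R) -> \bar R})
    (J : interval R) (A : set R) :
  nontrivial_itv J -> measurable A ->
  nu ([set` J] `&` A) =
    nu ([set` left_half J] `&` A) + nu ([set` right_half J] `&` A).
Proof.
move=> hJ mA; rewrite (halves_setU hJ) setIUl measureU//.
- by apply: measurableI => //; exact: measurable_itv.
- by apply: measurableI => //; exact: measurable_itv.
- by rewrite setIACA setIid (halves_setI hJ) set0I.
Qed.

Lemma itv_dist_le_len (J : interval R) x y : nontrivial_itv J ->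
  x \in J -> y \in J -> (y - x <= len J)%R.
Proof.
by case=> bl l br r lr; rewrite len_itv// !in_itv; case: bl; case: br => /=; lra.
Qed.

(* Replacing the interval by a neighbourhood makes the estimate additive over the
   two halves of J; at scale e, intervals meeting ]a, b[ lie in ]a - e, b + e[. *)
Lemma domination_nbhd (C a b e : R) n J : (0 <= C)%R -> nontrivial_itv J ->
  (forall K, dyadic J K -> mu [set` K] <= (C * len K)%:E) ->
  (len J < e * 2 ^+ n)%R ->
  mu ([set` J] `&` `]a, b[) <= C%:E * leb ([set` J] `&` `](a - e)%R, (b + e)%R[).
Proof.
move=> C0; elim: n J => [|n ih] J hJ hmu Jn.
  have [->|/set0P[y /= [yJ yK]]] := eqVneq ([set` J] `&` `]a, b[) set0.
    by rewrite measure0 mule_ge0// lee_fin.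
  have -> : [set` J] `&` `](a - e)%R, (b + e)%R[ = [set` J].
    apply/setIidPl => x /= xJ.
    have h1 := itv_dist_le_len hJ xJ yJ; have h2 := itv_dist_le_len hJ yJ xJ.
    rewrite expr0 mulr1 in Jn.
    by move: yK; rewrite !in_itv /= => /andP[*]; apply/andP; split; lra.
  rewrite lebesgue_measure_len// -EFinM.
  apply: le_trans (hmu _ (dyadic_self J)).
  by apply: measureIl => //; exact: measurable_itv.
rewrite measure_halves_setI// [X in _ * X]measure_halves_setI//.
rewrite ge0_muleDr// leeD//.
- apply: ih; first exact: nontrivial_left_half.
    by move=> K lK; apply: hmu; exact: dyadic_trans (dyadic_left_half J) lK.
  by rewrite len_left_half//; move: Jn; rewrite exprSr; lra.
- apply: ih; first exact: nontrivial_right_half.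
    by move=> K lK; apply: hmu; exact: dyadic_trans (dyadic_right_half J) lK.
  by rewrite len_right_half//; move: Jn; rewrite exprSr; lra.
Qed.

(** Extends the bound from dyadic intervals to arbitrary open ones, by letting [e] tend to 0 in
    [domination_nbhd]. *)
Lemma domination_itv (C a b : R) I : (0 <= C)%R -> nontrivial_itv I ->
  (forall J, dyadic I J -> mu [set` J] <= (C * len J)%:E) -> (a < b)%R ->
  mu ([set` I] `&` `]a, b[) <= (C * (b - a))%:E.
Proof.
move=> C0 hI hmu ab.
have h e : (0 < e)%R ->
    mu ([set` I] `&` `]a, b[) <= (C * (b - a))%:E + (C * (2 * e))%:E.
  move=> e0.
  have [n hn] : exists n : nat, (len I < e * 2 ^+ n)%R.
    exists (Num.truncn (len I / e)).+1.
    rewrite mulrC -ltr_pdivrMr//.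
    apply: lt_le_trans (_ : (Num.truncn (len I / e)).+1%:R <= _)%R.
      by rewrite truncnS_gt.
    by rewrite -natrX ler_nat ltnW// ltn_expl.
  apply: le_trans (domination_nbhd a b C0 hI hmu hn) _.
  rewrite -EFinD -mulrDr EFinM lee_wpmul2l ?lee_fin//.
  apply: (@le_trans _ _ (leb `](a - e)%R, (b + e)%R[)).
    by apply: measureIr => //; exact: measurable_itv.
  rewrite lebesgue_measure_itv_bnd ?lee_fin; lra.
apply/lee_addgt0Pr => e e0.
have [C00|C00] := eqVneq C 0%R.
  by have := h 1%R ltr01; rewrite C00 !mul0r add0e => /le_trans; apply; rewrite add0e lee_fin ltW.
have {C00}C0' : (0 < C)%R by rewrite lt_neqAle eq_sym C00.
have := h (e / (2 * C))%R; rewrite divr_gt0 ?mulr_gt0// => /(_ erefl).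
by have -> : (C * (2 * (e / (2 * C))) = e)%R by field; rewrite gt_eqF.
Qed.

(** Lebesgue measure is an infimum over covers by open intervals, and [domination_itv] applies to
    each of them. *)
Lemma domination_null C (I : interval R) (A : set R) :
  (0 <= C)%R -> nontrivial_itv I ->
  (forall J, dyadic I J -> mu [set` J] <= (C * len J)%:E) ->
  measurable A -> A `<=` [set` I] -> leb A = 0 -> mu A = 0.
Proof.
move=> C0 hI hmu mA AI A0; apply/eqP; rewrite eq_le measure_ge0 andbT.
(* [C + 1] can be inverted even when [C = 0]. *)
have C1 : (0 < C + 1)%R by rewrite ltr_wpDl.
suff : ((C + 1)^-1)%:E * mu A <= leb A by rewrite A0 lee_pdivrMl// mule0.
have -> : leb A = ((@wlength R idfun)^* A)%mu by [].
rewrite outer_measure_open_itv_cover; apply: le_ereal_inf_tmp => _ [F [hF AF] <-].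
rewrite lee_pdivrMl// -nneseriesZl; last first.
  by move=> i _; have [[a b] ->] := hF i; exact: wlength_itv_ge0.
apply: (@le_trans _ _ (\sum_(0 <= i <oo) mu ([set` I] `&` F i))).
  apply: measure_sigma_subadditive => //.
  - move=> i; have [ab ->] := hF i; apply: measurableI; exact: measurable_itv.
  - by move=> x Ax; have [i _ Fx] := AF _ Ax; exists i => //; split => //; exact: AI.
apply: lee_nneseries => // i _; have [[a b] ->] /= := hF i.
rewrite wlength_itv/= lte_fin; case: ltP => ab.
  apply: le_trans (domination_itv C0 hI hmu ab) _.
  by rewrite -EFinB -EFinM lee_fin ler_wpM2r ?subr_ge0 ?(ltW ab)// lerDl.
by rewrite set_itv_ge ?bnd_simp -?leNgt// setI0 measure0 mule0.
Qed.

End domination.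

(** * Dyadic averages *)

Section averages.
Variable R : realType.
Implicit Types (I J : interval R) (phi f : R -> R).
Notation leb := (@lebesgue_measure R).

Lemma integrable_itv_cst J (c : R) : nontrivial_itv J ->
  leb.-integrable [set` J] (EFin \o cst c).
Proof.
move=> hJ; apply/integrableP; split; first by apply/measurable_EFinP.
rewrite [ltLHS](integral_cst leb (measurable_itv J) `|c%:E|%E).
by rewrite /= lebesgue_measure_len// -EFinM ltry.
Qed.

Lemma avg_halves J f : nontrivial_itv J ->
  leb.-integrable [set` J] (EFin \o f) ->
  avg J f = (avg (left_half J) f + avg (right_half J) f) / 2.
Proof.
move=> hJ iJ; have l0 := gt_eqF (len_gt0 hJ).
rewrite /avg len_left_half// len_right_half//.
rewrite (halves_setU hJ) Rintegral_setU//.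
- by field; rewrite l0.
- by rewrite -halves_setU.
- by apply/disj_setPS; rewrite halves_setI.
Qed.

Lemma avg_cst J (c : R) : nontrivial_itv J -> avg J (fun=> c) = c.
Proof.
move=> hJ; rewrite /avg Rintegral_cst; last exact: measurable_itv.
rewrite /= lebesgue_measure_len//= mulrCA mulVf ?mulr1//.
by rewrite gt_eqF// len_gt0.
Qed.

Lemma square_integrable_sub I J phi : nontrivial_itv I -> nontrivial_itv J ->
  [set` J] `<=` [set` I] ->
  square_integrable I phi -> square_integrable J phi.
Proof.
move=> hI hJ JI [mphi iphi]; split.
  by apply: measurable_funS JI mphi; exact: measurable_itv.
by apply: (@integrableS _ (measurableTypeR R) _ _ [set` I]) => //;
  exact: measurable_itv.
Qed.

(** On a bounded interval [1 + phi ^+ 2] is integrable, and it dominates the absolute value of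
    [phi]. *)
Lemma square_integrable_integrable J phi : nontrivial_itv J ->
  square_integrable J phi -> leb.-integrable [set` J] (EFin \o phi).
Proof.
move=> hJ [mphi iphi].
have mJ : measurable [set` J] by exact: measurable_itv.
apply: (@le_integrable _ (measurableTypeR R) _ _ _ _ _ (EFin \o (fun t => 1 + phi t ^+ 2))) => //.
- exact/measurable_EFinP.
- move=> t _; rewrite /= lee_fin.
  rewrite (ger0_norm (_ : 0 <= 1 + _)) ?addr_ge0 ?sqr_ge0// ler_norml.
  have := sqr_ge0 (phi t - 1); have := sqr_ge0 (phi t + 1).
  by have := sqr_ge0 (phi t) => *; apply/andP; split; lra.
- have -> : EFin \o (fun t => 1 + phi t ^+ 2) =
     (fun t => (EFin \o cst 1%R) t + (phi t ^+ 2)%:E)%E by apply/funext.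
  by apply: integrableD => //; exact: integrable_itv_cst.
Qed.

(** Integrate [2 * c * phi - c ^+ 2 <= phi ^+ 2], where [c] is the average of [phi]. *)
Lemma avg_sqr_le J phi : nontrivial_itv J -> square_integrable J phi ->
  avg J phi ^+ 2 <= avg J (fun t => phi t ^+ 2).
Proof.
move=> hJ sphi; have iphi := square_integrable_integrable hJ sphi.
have mJ : measurable [set` J] by exact: measurable_itv.
set c := avg J phi.
have i1 : leb.-integrable [set` J] (EFin \o (fun t => 2 * c * phi t)).
  rewrite (_ : _ \o _ = (fun t => (2 * c)%:E * (phi t)%:E))%E; last first.
    by apply/funext => t; rewrite /= EFinM.
  exact: integrableZl.
have i2 := integrable_itv_cst (c ^+ 2) hJ.
have l0 := len_gt0 hJ.
have h : \int[leb]_(t in [set` J]) (2 * c * phi t - c ^+ 2) <=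
    \int[leb]_(t in [set` J]) (phi t ^+ 2).
  apply: le_Rintegral => //; last 2 first.
  - by case: sphi.
  - by move=> t _; have := sqr_ge0 (phi t - c); lra.
  - rewrite (_ : _ \o _ = (fun t => (EFin \o (fun t => 2 * c * phi t)%R) t -
       (EFin \o cst (c ^+ 2)%R) t)%E); last by apply/funext.
    exact: integrableB.
move: h; rewrite RintegralB// RintegralZl// Rintegral_cst//.
rewrite /= lebesgue_measure_len//= => h.
rewrite /avg -(ler_pM2l l0) mulVKf ?gt_eqF//; apply: le_trans h.
have -> : \int[leb]_(x in [set` J]) phi x = c * len J.
  by rewrite /c /avg mulrAC mulVf ?mul1r// gt_eqF.
lra.
Qed.

End averages.

(** * Dyadic averages of a given generation as step functions *)

Section dyadic_expectation.
Variable R : realType.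
Implicit Types (I J : interval R) (phi : R -> R).

(* Meaningful only for t in J: outside J it is an extreme subinterval. *)
Fixpoint dyadic_at (n : nat) (J : interval R) (t : R) : interval R :=
  if n is n'.+1 then
    if t < miditv J then dyadic_at n' (left_half J) t
    else dyadic_at n' (right_half J) t
  else J.

Definition dyadic_avg n J phi t := avg (dyadic_at n J t) phi.

Lemma miditvE bl (l : R) br r :
  miditv (Interval (BSide bl l) (BSide br r)) = (l + r) / 2.
Proof. by rewrite /miditv; field. Qed.

Lemma left_half_lt J t : nontrivial_itv J -> t \in left_half J -> t < miditv J.
Proof.
by case=> bl l br r lr; rewrite left_halfE miditvE in_itv /= => /andP[].
Qed.

Lemma right_half_lt J t : nontrivial_itv J ->
  t \in right_half J -> (t < miditv J) = false.
Proof.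
case=> bl l br r lr; rewrite right_halfE miditvE in_itv /= => /andP[h _].
by rewrite ltNge h.
Qed.

Lemma mem_left_half J t : nontrivial_itv J ->
  t \in J -> t < miditv J -> t \in left_half J.
Proof.
case=> bl l br r lr; rewrite left_halfE miditvE !in_itv /= => /andP[h _] ->.
by rewrite h.
Qed.

Lemma mem_right_half J t : nontrivial_itv J ->
  t \in J -> (t < miditv J) = false -> t \in right_half J.
Proof.
case=> bl l br r lr; rewrite right_halfE miditvE !in_itv /= => /andP[_ h].
by move=> /negbT; rewrite -leNgt => ->; rewrite h.
Qed.

Lemma dyadic_atP n J t : nontrivial_itv J -> t \in J ->
  [/\ t \in dyadic_at n J t, nontrivial_itv (dyadic_at n J t),
     dyadic J (dyadic_at n J t) & len (dyadic_at n J t) = len J / 2 ^+ n].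
Proof.
elim: n J => [|n ih] J hJ tJ /=.
  by split => //; [exact: dyadic_self | rewrite expr0 divr1].
case: ifPn => [tm|/negbTE tm].
  have [] := ih _ (nontrivial_left_half hJ) (mem_left_half hJ tJ tm).
  rewrite len_left_half// => ? ? /(dyadic_trans (dyadic_left_half J)) ? ->.
  by split=> //; rewrite exprS invfM mulrA.
have [] := ih _ (nontrivial_right_half hJ) (mem_right_half hJ tJ tm).
rewrite len_right_half// => ? ? /(dyadic_trans (dyadic_right_half J)) ? ->.
by split=> //; rewrite exprS invfM mulrA.
Qed.

Lemma dyadic_avg_left n J phi t : nontrivial_itv J -> t \in left_half J ->
  dyadic_avg n.+1 J phi t = dyadic_avg n (left_half J) phi t.
Proof. by move=> hJ tJ; rewrite /dyadic_avg /= left_half_lt. Qed.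

Lemma dyadic_avg_right n J phi t : nontrivial_itv J -> t \in right_half J ->
  dyadic_avg n.+1 J phi t = dyadic_avg n (right_half J) phi t.
Proof. by move=> hJ tJ; rewrite /dyadic_avg /= right_half_lt. Qed.

Lemma measurable_dyadic_avg n J phi : nontrivial_itv J ->
  measurable_fun ([set` J] : set (measurableTypeR R)) (dyadic_avg n J phi).
Proof.
elim: n J => [|n ih] J hJ.
  by rewrite (_ : dyadic_avg 0 J phi = cst (avg J phi)).
rewrite (halves_setU hJ); apply/measurable_funU; try exact: measurable_itv.
split.
  apply: eq_measurable_fun (ih _ (nontrivial_left_half hJ)) => t /set_mem tJ.
  by rewrite dyadic_avg_left.
apply: eq_measurable_fun (ih _ (nontrivial_right_half hJ)) => t /set_mem tJ.
by rewrite dyadic_avg_right.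
Qed.

End dyadic_expectation.

(** * Bellman induction *)

Section carleson_density.
Variable R : realType.
Variable mu : {measure set (measurableTypeR R) -> \bar R}.
Variable alpha : interval R -> R.
Implicit Types (I J : interval R) (m M : R).

Definition carleson_bounds m M I := forall J, dyadic I J ->
  0 <= alpha J /\
  ((m * len J)%:E <= carleson_mass mu alpha J <= (M * len J)%:E)%E.

(** The third Bellman variable at [J]. Under [carleson_bounds] the mass is finite, so [fine] loses
    nothing. *)
Definition carleson_density J : R := fine (carleson_mass mu alpha J) / len J.

Lemma carleson_bounds_dyadic m M I J : dyadic I J ->
  carleson_bounds m M I -> carleson_bounds m M J.
Proof. by move=> IJ h K JK; apply: h; exact: dyadic_trans JK. Qed.

Lemma carleson_mass_halves J : nontrivial_itv J ->
  (forall K, dyadic J K -> 0 <= alpha K) ->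
  (carleson_mass mu alpha J = carleson_mass mu alpha (left_half J) +
    carleson_mass mu alpha (right_half J) + (alpha J)%:E)%E.
Proof.
move=> hJ a0; rewrite /carleson_mass esum_dyadic//.
have := @measure_halves_setI _ mu J setT hJ measurableT.
rewrite !setIT => ->.
set s := esum _ _; set t := esum _ _.
by rewrite (addeC (alpha J)%:E) !addeA -!addeA; congr (_ + _)%E;
   rewrite addeCA.
Qed.

Lemma carleson_densityP m M J : nontrivial_itv J -> carleson_bounds m M J ->
  [/\ carleson_mass mu alpha J = (len J * carleson_density J)%:E,
    m <= carleson_density J & carleson_density J <= M].
Proof.
move=> hJ hb; have [_ /andP[h1 h2]] := hb _ (dyadic_self J).
have l0 := len_gt0 hJ.
have e : carleson_mass mu alpha J = (len J * carleson_density J)%:E.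
  rewrite /carleson_density mulrC divfK ?gt_eqF// fineK// fin_numE.
  by apply/andP; split; apply/eqP => E; move: h1 h2; rewrite E.
by move: h1 h2; rewrite e !lee_fin ![_ * len J]mulrC !ler_pM2l.
Qed.

(** The evolution of the third variable: the [d] of [majorant_main] is [alpha J / len J]. *)
Lemma carleson_density_halves m M J : nontrivial_itv J ->
  carleson_bounds m M J ->
  carleson_density J = (carleson_density (left_half J) +
    carleson_density (right_half J)) / 2 + alpha J / len J.
Proof.
move=> hJ hb.
have a0 K : dyadic J K -> 0 <= alpha K by move=> /hb[].
have [eJ _ _] := carleson_densityP hJ hb.
have [el _ _] := carleson_densityP (nontrivial_left_half hJ)
  (carleson_bounds_dyadic (dyadic_left_half J) hb).
have [er _ _] := carleson_densityP (nontrivial_right_half hJ)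
  (carleson_bounds_dyadic (dyadic_right_half J) hb).
have := carleson_mass_halves hJ a0; rewrite eJ el er -!EFinD => -[].
have l0 := len_gt0 hJ; rewrite len_left_half// len_right_half// => e.
apply: (mulfI (lt0r_neq0 l0)); rewrite e.
by field; rewrite gt_eqF.
Qed.

End carleson_density.

Section bellman_induction.
Local Open Scope ereal_scope.
Variable R : realType.
Variable mu : {measure set (measurableTypeR R) -> \bar R}.
Variable alpha : interval R -> R.
Variable phi : R -> R.
Variables m M : R.
Variable b : R -> R -> R -> R.
Hypothesis b_ge : forall x1 x2 x3 : R, (x1 ^+ 2 <= x2 -> m <= x3 -> x3 <= M ->
  x1 ^+ 2 * x3 <= b x1 x2 x3)%R.
Hypothesis b_main : forall x1 x2 x3 y1 y2 y3 d : R,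
  (x1 ^+ 2 <= x2 -> m <= x3 -> y1 ^+ 2 <= y2 -> m <= y3 ->
   0 <= d -> (x3 + y3) / 2 + d <= M ->
   (b x1 x2 x3 + b y1 y2 y3) / 2 + ((x1 + y1) / 2) ^+ 2 * d <=
   b ((x1 + y1) / 2) ((x2 + y2) / 2) ((x3 + y3) / 2 + d))%R.

(** The function [b] is left abstract because two kinds are needed: the majorants and, for [x3 = m],
    the function [m * x2]. Below depth [n], [phi] is replaced by its averages over generation
    [n]. *)
Lemma bellman_induction n J : nontrivial_itv J -> square_integrable J phi ->
  carleson_bounds mu alpha m M J ->
  \int[mu]_(t in [set` J]) (dyadic_avg n J phi t ^+ 2)%:E +
    \esum_(K in dyadic_upto n J) (avg K phi ^+ 2 * alpha K)%:E <=
  (len J * b (avg J phi) (avg J (fun t => phi t ^+ 2))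
             (carleson_density mu alpha J))%:E.
Proof.
elim: n J => [|n ih] J hJ sphi hb.
  have [eJ h1 h2] := carleson_densityP hJ hb.
  rewrite esum_set0 adde0.
  rewrite (_ : (fun t => _) = cst (avg J phi ^+ 2)%:E)//.
  rewrite integral_cst; last exact: measurable_itv.
  (* At depth 0 only [mu] counts, and its mass on [J] is at most the full Carleson mass. *)
  apply: (@le_trans _ _ ((avg J phi ^+ 2)%:E * carleson_mass mu alpha J)).
    rewrite lee_wpmul2l ?lee_fin ?sqr_ge0// leeDl// esum_ge0// => K /hb[a0 _].
    by rewrite lee_fin.
  rewrite eJ -EFinM lee_fin mulrCA ler_pM2l ?len_gt0//.
  by apply: b_ge => //; exact: avg_sqr_le.
have hl := nontrivial_left_half hJ; have hr := nontrivial_right_half hJ.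
have sl := square_integrable_sub hJ hl (left_half_sub hJ) sphi.
have sr := square_integrable_sub hJ hr (right_half_sub hJ) sphi.
have bl := carleson_bounds_dyadic (dyadic_left_half J) hb.
have br := carleson_bounds_dyadic (dyadic_right_half J) hb.
have a0 K : dyadic J K -> (0 <= alpha K)%R by move=> /hb[].
rewrite esum_dyadic_upto//; last first.
  by move=> K /a0 aK; rewrite lee_fin mulr_ge0// sqr_ge0.
have mJ : measurable ([set` J] : set (measurableTypeR R)) by exact: measurable_itv.
rewrite {1}(halves_setU hJ) ge0_integral_setU; first last.
- by apply/disj_setPS; rewrite halves_setI.
- by move=> t _; rewrite lee_fin sqr_ge0.
- apply/measurable_EFinP; rewrite -halves_setU//.
  by apply: measurable_funX; exact: measurable_dyadic_avg.
- exact: measurable_itv.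
- exact: measurable_itv.
under eq_integral => t /set_mem tl do rewrite dyadic_avg_left//.
under [X in _ + X + _]eq_integral => t /set_mem tr do rewrite dyadic_avg_right//.
rewrite addeCA addeACA.
apply: (le_trans (leeD (lexx _) (leeD (ih _ hl sl bl) (ih _ hr sr br)))).
rewrite -!EFinD lee_fin.
have iphi := square_integrable_integrable hJ sphi.
rewrite (avg_halves hJ iphi) (avg_halves hJ sphi.2).
rewrite (carleson_density_halves hJ hb) len_left_half// len_right_half//.
have [_ l1 l2] := carleson_densityP hl bl.
have [_ r1 r2] := carleson_densityP hr br.
have l0 := len_gt0 hJ.
have aJ : (0 <= alpha J / len J)%R.
  by rewrite divr_ge0 ?(ltW l0)//; exact/a0/dyadic_self.
have hM : ((carleson_density mu alpha (left_half J) +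
    carleson_density mu alpha (right_half J)) / 2 + alpha J / len J <= M)%R.
  by rewrite -(carleson_density_halves hJ hb); have [] := carleson_densityP hJ hb.
have := b_main (avg_sqr_le hl sl) l1 (avg_sqr_le hr sr) r1 aJ hM.
rewrite -(ler_pM2l l0) => /(le_trans _); apply.
rewrite le_eqVlt; apply/orP; left; apply/eqP.
by field; rewrite gt_eqF.
Qed.

End bellman_induction.

(** * Almost everywhere convergence of dyadic averages *)

Section dyadic_differentiation.
Local Open Scope ereal_scope.
Variable R : realType.
Implicit Types I J : interval R.
Notation leb := (@lebesgue_measure R).

(** The dyadic interval of generation [n] around [t] lies in the ball of twice its length about [t],
    whose measure is 4 times that length. *)
Lemma dyadic_at_nicely_shrinking I t : nontrivial_itv I -> t \in I ->
  nicely_shrinking t (fun n => [set` dyadic_at n I t]).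
Proof.
move=> hI tI; split; first by move=> n; exact: measurable_itv.
have l0 := len_gt0 hI.
have r0 n : (0 < len I / 2 ^+ n * 2)%R.
  by rewrite mulr_gt0// divr_gt0// exprn_gt0.
exists (4%R, fun n => PosNum (r0 n)); split => //=.
- rewrite -(mul0r (2%R : R)); apply: cvgMr_tmp.
  rewrite -(mulr0 (len I)); apply: cvgMl_tmp.
  under eq_fun do rewrite -exprVn.
  by apply: cvg_expr; rewrite ger0_norm ?invr_ge0// invf_lt1// ltr1n.
- move=> n y /= yJ; have [tJ hJ _ eJ] := dyadic_atP n hI tI.
  have h1 := itv_dist_le_len hJ tJ yJ; have h2 := itv_dist_le_len hJ yJ tJ.
  have d0 : (0 < len I / 2 ^+ n)%R by rewrite divr_gt0// exprn_gt0.
  rewrite /ball /= ltr_norml; apply/andP; split; lra.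
- move=> n; have [tJ hJ _ eJ] := dyadic_atP n hI tI.
  rewrite lebesgue_measure_ball ?(ltW (r0 n))// lebesgue_measure_len// eJ.
  rewrite -EFinM lee_fin -mulr_natl; lra.
Qed.

(** Lebesgue differentiation for [phi] extended by 0. The exceptional set is given explicitly so
    that it can later be shown to be null for [mu] as well. *)
Lemma dyadic_avg_cvg I (phi : R -> R) : nontrivial_itv I ->
  leb.-integrable [set` I] (EFin \o phi) ->
  exists N, [/\ measurable (N : set (measurableTypeR R)), leb N = 0 &
    forall t, t \in I -> ~ N t ->
      (dyadic_avg n I phi t)%:E @[n --> \oo] --> (phi t)%:E].
Proof.
move=> hI iphi.
have mI : measurable [set` I] by exact: measurable_itv.
have := lebesgue_differentiation (integrable_locally_restrict mI iphi).
move=> [N [mN N0 HN]]; exists N; split => // t tI Nt.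
(* Outside I any nicely shrinking family will do. *)
pose I' x := if x \in I then I else `[x, (x + 1)%R].
have hI' x : nontrivial_itv (I' x).
  by rewrite /I'; case: ifP => // _; split; rewrite ltrDl.
have xI' x : x \in I' x.
  by rewrite /I'; case: ifPn => // _; rewrite in_itv/= lexx lerDl ler01.
have hE x := dyadic_at_nicely_shrinking (hI' x) (xI' x).
have ht : lebesgue_pt (phi \_ [set` I]) t by apply: contrapT => /HN.
have := nice_lebesgue_differentiation hE
  (integrable_locally_restrict mI iphi) ht.
rewrite patchE mem_set//=; apply: cvg_trans; apply: near_eq_cvg.
near=> n; rewrite /I' tI.
have [tJ hJ IJ eJ] := dyadic_atP n hI tI.
rewrite lebesgue_measure_len// inver gt_eqF ?len_gt0//.
rewrite (@eq_integral _ (measurableTypeR R) _ _ _ (EFin \o phi)); last first.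
  move=> y /set_mem yJ; rewrite patchE mem_set//.
  exact: (dyadic_sub hI IJ).
rewrite /dyadic_avg /avg EFinM /Rintegral fineK//.
apply: integrable_fin_num; first exact: measurable_itv.
apply: (@integrableS _ (measurableTypeR R) _ _ [set` I]) => //.
exact: dyadic_sub.
Unshelve. all: by end_near. Qed.

End dyadic_differentiation.

(** * Passage to the limit in the Bellman induction *)

Section carleson_value_bound.
Local Open Scope ereal_scope.
Variable R : realType.
Variable mu : {measure set (measurableTypeR R) -> \bar R}.
Implicit Types I J : interval R.

Lemma le_esum_set (T : choiceType) (A B : set T) (f : T -> \bar R) :
  A `<=` B -> \esum_(i in A) f i <= \esum_(i in B) f i.
Proof.
move=> AB; apply: ge_ereal_sup => _ [X [finX XA] <-].
apply: ereal_sup_ubound; exists X => //; split => //.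
exact: subset_trans AB.
Qed.

Lemma limn_einf_le (u : (\bar R)^nat) x n :
  (forall k, (n <= k)%N -> u k <= x) -> limn_einf u <= x.
Proof.
move=> ux; rewrite limn_einf_lim; apply: lime_le; first exact: is_cvg_einfs.
near=> k; apply: (@le_trans _ _ (u k)).
  by apply: ereal_inf_lbound; exists k => /=.
by apply: ux; near: k; exact: nbhs_infty_ge.
Unshelve. all: by end_near. Qed.

Lemma integral_sqr_le_limn_einf I (phi : R -> R) C : nontrivial_itv I ->
  square_integrable I phi -> (0 <= C)%R ->
  (forall J, dyadic I J -> mu [set` J] <= (C * len J)%:E) ->
  \int[mu]_(t in [set` I]) (phi t ^+ 2)%:E <=
  limn_einf (fun n => \int[mu]_(t in [set` I]) (dyadic_avg n I phi t ^+ 2)%:E).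
Proof.
move=> hI sphi C0 hmu.
have [N [mN N0 HN]] := dyadic_avg_cvg hI (square_integrable_integrable hI sphi).
have mI : measurable ([set` I] : set (measurableTypeR R)) by exact: measurable_itv.
(* [mu] is controlled only inside [I], so the exceptional set is cut down to [I] before domination
   makes it null. *)
have mNI : measurable (N `&` [set` I] : set (measurableTypeR R)).
  exact: measurableI.
have mD : measurable ([set` I] `\` (N `&` [set` I]) : set (measurableTypeR R)).
  exact: measurableD.
have NI0 : mu (N `&` [set` I]) = 0.
  apply: (domination_null C0 hI hmu) => //.
  by apply: (subset_measure0 mNI mN) => //; exact: subIsetl.
have mphi : measurable_fun ([set` I] : set (measurableTypeR R)) phi := sphi.1.
have mavg n : measurable_fun ([set` I] : set (measurableTypeR R))
    (fun t => (dyadic_avg n I phi t ^+ 2)%:E).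
  by apply/measurable_EFinP/measurable_funX; exact: measurable_dyadic_avg.
rewrite (ge0_negligible_integral mNI)//; last 2 first.
- exact/measurable_EFinP/measurable_funX.
- by move=> t _; rewrite lee_fin sqr_ge0.
rewrite (@eq_integral _ (measurableTypeR R) _ _ _
    (fun t => limn_einf (fun n => (dyadic_avg n I phi t ^+ 2)%:E))); last first.
  move=> t /set_mem [tI /= Nt].
  have /HN : t \in I by [].
  move=> /(_ (fun Nt' => Nt (conj Nt' tI))) h.
  have {}h : (fun n => dyadic_avg n I phi t) @ \oo --> phi t := fine_cvg h.
  have h2 : (dyadic_avg n I phi t ^+ 2)%:E @[n --> \oo] --> (phi t ^+ 2)%:E.
    apply: cvg_EFin; first exact: nearW.
    have -> : fine \o (fun n => (dyadic_avg n I phi t ^+ 2)%:E) =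
      (fun n => dyadic_avg n I phi t * dyadic_avg n I phi t)%R by apply/funext.
    by rewrite expr2; apply: cvgM; exact: h.
  by rewrite (cvg_limn_einf_sup h2).1.
apply: (@le_trans _ _ (limn_einf (fun n =>
    \int[mu]_(t in [set` I] `\` (N `&` [set` I]))
      (dyadic_avg n I phi t ^+ 2)%:E))).
  apply: fatou => //; last by move=> n t _; rewrite lee_fin sqr_ge0.
  by move=> n; apply: measurable_funS (mavg n) => //; exact: subDsetl.
rewrite !limn_einf_lim; apply: lee_lim; try exact: is_cvg_einfs.
apply: nearW => n; apply: le_ereal_inf_tmp => _ [k nk <-].
apply: (@le_trans _ _ (\int[mu]_(t in [set` I] `\` (N `&` [set` I]))
      (dyadic_avg k I phi t ^+ 2)%:E)).
  by apply: ereal_inf_lbound; exists k.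
apply: ge0_subset_integral => //.
by move=> t _; rewrite lee_fin sqr_ge0.
Qed.

Lemma carleson_value_le (m M : R) (b : R -> R -> R -> R) alpha phi I :
  (forall x1 x2 x3 : R, (x1 ^+ 2 <= x2 -> m <= x3 -> x3 <= M ->
    x1 ^+ 2 * x3 <= b x1 x2 x3)%R) ->
  (forall x1 x2 x3 y1 y2 y3 d : R,
    (x1 ^+ 2 <= x2 -> m <= x3 -> y1 ^+ 2 <= y2 -> m <= y3 ->
     0 <= d -> (x3 + y3) / 2 + d <= M ->
     (b x1 x2 x3 + b y1 y2 y3) / 2 + ((x1 + y1) / 2) ^+ 2 * d <=
     b ((x1 + y1) / 2) ((x2 + y2) / 2) ((x3 + y3) / 2 + d))%R) ->
  nontrivial_itv I -> square_integrable I phi -> (0 <= M)%R ->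
  carleson_bounds mu alpha m M I ->
  carleson_value I phi mu alpha <=
    (b (avg I phi) (avg I (fun t => phi t ^+ 2)%R)
       (carleson_density mu alpha I))%:E.
Proof.
move=> b_ge b_main hI sphi M0 hb.
have l0 := len_gt0 hI.
rewrite /carleson_value lee_pdivrMl// -EFinM.
set c := (_ * _)%R.
have bi n : _ <= c%:E := bellman_induction b_ge b_main n hI sphi hb.
have a0 K : dyadic I K -> (0 <= alpha K)%R by move=> /hb[].
under eq_integral do rewrite real_normK ?num_real//.
under eq_esum => K _ do rewrite real_normK ?num_real//.
have sum0 A : A `<=` dyadic I ->
    0 <= \esum_(K in A) (avg K phi ^+ 2 * alpha K)%:E.
  by move=> AI; apply: esum_ge0 => K /AI/a0 aK; rewrite lee_fin mulr_ge0 ?sqr_ge0.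
have int0 (f : R -> R) : 0 <= \int[mu]_(t in [set` I]) (f t ^+ 2)%:E.
  by apply: integral_ge0 => t _; rewrite lee_fin sqr_ge0.
have hmu J : dyadic I J -> mu [set` J] <= (M * len J)%:E.
  move=> IJ; have [_ /andP[_]] := hb _ IJ; apply: le_trans.
  rewrite leeDl// esum_ge0// => K JK.
  by rewrite lee_fin; exact/a0/dyadic_trans/JK.
(* Two separate limits: the depth [n] of the sum is fixed while the depth [k >= n] of the averages
   grows, the sum to depth [n] being at most the one to depth [k]. Afterwards [n] grows. *)
have key n : \int[mu]_(t in [set` I]) (phi t ^+ 2)%:E +
    \esum_(K in dyadic_upto n I) (avg K phi ^+ 2 * alpha K)%:E <= c%:E.
  set S := \esum_(K in dyadic_upto n I) _.
  have S0 : 0 <= S by apply: sum0; exact: dyadic_upto_sub.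
  have Sfin : S \is a fin_num.
    rewrite ge0_fin_numE//; apply: le_lt_trans (ltry c).
    by apply: le_trans (bi n); rewrite leeDr.
  rewrite -leeBrDr//.
  apply: le_trans (integral_sqr_le_limn_einf hI sphi M0 hmu) _.
  apply: (@limn_einf_le _ _ n) => k nk; rewrite leeBrDr//.
  apply: le_trans (bi k); rewrite leeD2l//.
  by apply: le_esum_set; exact: dyadic_upto_le.
set T := \int[mu]_(t in _) _.
have Tfin : T \is a fin_num.
  rewrite ge0_fin_numE; last exact: int0.
  apply: le_lt_trans (ltry c); apply: le_trans (key 0%N).
  by rewrite leeDl//; apply: sum0; exact: dyadic_upto_sub.
rewrite -leeBrDl//; apply: esum_dyadic_le => [K /a0 aK|n].
  by rewrite lee_fin mulr_ge0 ?sqr_ge0.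
by rewrite leeBrDl//; exact: key.
Qed.

End carleson_value_bound.

(** * Realization of the reached values *)

Section realization.
Variable R : realType.
Implicit Types (I J K : interval R) (D : R).
Notation leb := (@lebesgue_measure R).

Lemma eq_avg J (f g : R -> R) : {in [set` J], f =1 g} -> avg J f = avg J g.
Proof. by move=> fg; rewrite /avg; congr (_ * _); exact: eq_Rintegral. Qed.

Lemma integrable_halves J (f : R -> R) : nontrivial_itv J ->
  leb.-integrable [set` left_half J] (EFin \o f) ->
  leb.-integrable [set` right_half J] (EFin \o f) ->
  leb.-integrable [set` J] (EFin \o f).
Proof.
move=> hJ /integrableP[ml il] /integrableP[mr ir].
have mf : measurable_fun ([set` J] : set (measurableTypeR R)) (EFin \o f).
  by rewrite (halves_setU hJ); apply/measurable_funU => //; exact: measurable_itv.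
apply/integrableP; split => //.
rewrite (halves_setU hJ) ge0_integral_setU//.
- by rewrite lte_add_pinfty.
- by rewrite -halves_setU//; exact: measurableT_comp.
- by apply/disj_setPS; rewrite halves_setI.
Qed.

Lemma square_integrable_halves J (phi : R -> R) : nontrivial_itv J ->
  square_integrable (left_half J) phi -> square_integrable (right_half J) phi ->
  square_integrable J phi.
Proof.
move=> hJ [ml il] [mr ir]; split; last exact: integrable_halves.
by rewrite (halves_setU hJ); apply/measurable_funU => //; exact: measurable_itv.
Qed.

Lemma eq_square_integrable J (f g : R -> R) : {in [set` J], f =1 g} ->
  square_integrable J f -> square_integrable J g.
Proof.
move=> fg [mf iF]; split; first exact: eq_measurable_fun mf.
apply: (@eq_integrable _ (measurableTypeR R) _ _ _ _ (fun t => (f t ^+ 2)%:E)) => //.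
by move=> t tJ; rewrite fg.
Qed.

(** [D] stands for [M - m], the factor that undoes the normalization of [reach]. No measure occurs
    here: [reach_bellman_ge] adds [m] times Lebesgue measure. *)
Definition realizes D I (phi : R -> R) (alpha : interval R -> R) x1 x2 z v :=
  [/\ square_integrable I phi,
    forall J, 0 <= alpha J,
    avg I phi = x1 /\ avg I (fun t => phi t ^+ 2) = x2,
    (\esum_(J in dyadic I) (alpha J)%:E = (D * z * len I)%:E)%E /\
    (\esum_(J in dyadic I) (avg J phi ^+ 2 * alpha J)%:E = (D * v * len I)%:E)%E &
    forall J, dyadic I J ->
      (\esum_(K in dyadic J) (alpha K)%:E <= (D * len J)%:E)%E].

Lemma realizes_leaf D I c d : nontrivial_itv I -> 0 <= D -> 0 <= d <= 1 ->
  realizes D I (fun=> c) (fun J => if J == I then D * d * len I else 0)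
    c (c ^+ 2) d (c ^+ 2 * d).
Proof.
move=> hI D0 /andP[d0 d1]; have l0 := len_gt0 hI.
have a0 J : 0 <= (if J == I then D * d * len I else 0).
  by case: ifP => // _; rewrite !mulr_ge0// ltW.
have mI : measurable ([set` I] : set (measurableTypeR R)) by exact: measurable_itv.
have off J : dyadic (left_half I) J \/ dyadic (right_half I) J ->
    (J == I) = false.
  move=> hJ; apply/eqP => E; move: hJ; rewrite E.
  by case; [exact: not_dyadic_left_half | exact: not_dyadic_right_half].
have sumI (f : interval R -> R) : (forall J, 0 <= f J) ->
    (\esum_(J in dyadic I) (f J * (if J == I then D * d * len I else 0))%:E =
     (f I * (D * d * len I))%:E)%E.
  move=> f0; rewrite esum_dyadic//; last first.
    by move=> J _; rewrite lee_fin mulr_ge0.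
  rewrite eqxx !esum1 ?adde0// => J hJ; rewrite off ?mulr0//.
    by right.
  by left.
split => //.
- by split => //; exact: integrable_itv_cst.
- by rewrite !avg_cst.
- split.
    have := sumI (fun=> 1) (fun=> ler01).
    by under eq_esum do rewrite mul1r; rewrite mul1r.
  rewrite (eq_esum (b := fun J => (c ^+ 2 *
      (if J == I then D * d * len I else 0))%:E)).
    by rewrite sumI => [|J]; [congr (_%:E); ring | exact: sqr_ge0].
  by move=> J IJ; rewrite avg_cst//; exact: nontrivial_dyadic IJ.
- move=> J; rewrite dyadic_setU => -[->|hJ].
    have := sumI (fun=> 1) (fun=> ler01).
    under eq_esum do rewrite mul1r.
    by rewrite mul1r => ->; rewrite lee_fin ler_pM2r// ler_piMr.
  rewrite esum1 ?lee_fin.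
    rewrite mulr_ge0//; apply/ltW/len_gt0; apply: (nontrivial_dyadic hI).
    by rewrite dyadic_setU; right.
  move=> K JK; rewrite off//.
  by case: hJ => hJ; [left|right]; exact: dyadic_trans JK.
Qed.

(** The two subtrees are disjoint and neither contains [I], so the glued family agrees with [alpha1]
    and [alpha2] on them and the coefficient at [I] is free. *)
Lemma realizes_node D I phi1 alpha1 phi2 alpha2 x1 x2 z v y1 y2 w u d :
  nontrivial_itv I -> 0 <= D ->
  realizes D (left_half I) phi1 alpha1 x1 x2 z v ->
  realizes D (right_half I) phi2 alpha2 y1 y2 w u ->
  0 <= d -> (z + w) / 2 + d <= 1 ->
  realizes D I (fun t => if t < miditv I then phi1 t else phi2 t)
    (fun J => if J == I then D * d * len I else
      if `[< dyadic (left_half I) J >] then alpha1 J else alpha2 J)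
    ((x1 + y1) / 2) ((x2 + y2) / 2) ((z + w) / 2 + d)
    ((v + u) / 2 + ((x1 + y1) / 2) ^+ 2 * d).
Proof.
move=> hI D0 [sq1 a1 [av1 av1'] [su1 su1'] bd1].
move=> [sq2 a2 [av2 av2'] [su2 su2'] bd2] d0 zw.
set phi := (X in realizes _ _ X); set alpha := (X in realizes _ _ _ X).
have l0 := len_gt0 hI.
have hl := nontrivial_left_half hI; have hr := nontrivial_right_half hI.
have phil : {in [set` left_half I], phi1 =1 phi}.
  by move=> t /set_mem tl; rewrite /phi left_half_lt.
have phir : {in [set` right_half I], phi2 =1 phi}.
  by move=> t /set_mem tr; rewrite /phi right_half_lt.
have phil2 : {in [set` left_half I], (fun t => phi1 t ^+ 2) =1 (fun t => phi t ^+ 2)}.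
  by move=> t /phil /= ->.
have phir2 : {in [set` right_half I], (fun t => phi2 t ^+ 2) =1 (fun t => phi t ^+ 2)}.
  by move=> t /phir /= ->.
have alphal J : dyadic (left_half I) J -> alpha J = alpha1 J.
  move=> hJ; rewrite /alpha asboolT//.
  by case: eqP => // E; move: hJ; rewrite E => /not_dyadic_left_half.
have alphar J : dyadic (right_half I) J -> alpha J = alpha2 J.
  move=> hJ; rewrite /alpha asboolF; last by move=> /dyadic_halves_disj; apply.
  by case: eqP => // E; move: hJ; rewrite E => /not_dyadic_right_half.
have alphaI : alpha I = D * d * len I by rewrite /alpha eqxx.
have alpha0 J : 0 <= alpha J.
  by rewrite /alpha; case: ifP => _; [rewrite !mulr_ge0// ltW | case: ifP].
have sq : square_integrable I phi.
  by apply: square_integrable_halves => //;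
    [exact: eq_square_integrable sq1 | exact: eq_square_integrable sq2].
have av : avg I phi = (x1 + y1) / 2.
  rewrite avg_halves//; last exact: square_integrable_integrable.
  by rewrite -(eq_avg phil) -(eq_avg phir) av1 av2.
have suml J : dyadic (left_half I) J ->
    (\esum_(K in dyadic J) (alpha K)%:E = \esum_(K in dyadic J) (alpha1 K)%:E)%E.
  by move=> hJ; apply: eq_esum => K JK; rewrite alphal//; exact: dyadic_trans JK.
have sumr J : dyadic (right_half I) J ->
    (\esum_(K in dyadic J) (alpha K)%:E = \esum_(K in dyadic J) (alpha2 K)%:E)%E.
  by move=> hJ; apply: eq_esum => K JK; rewrite alphar//; exact: dyadic_trans JK.
have sumI : (\esum_(J in dyadic I) (alpha J)%:E =
    (D * ((z + w) / 2 + d) * len I)%:E)%E.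
  rewrite esum_dyadic//; last by move=> J _; rewrite lee_fin.
  rewrite suml ?sumr; try exact: dyadic_self.
  rewrite su1 su2 alphaI -!EFinD len_left_half// len_right_half//.
  by congr _%:E; field.
split => //.
- split => //; rewrite avg_halves//; last by case: sq.
  by rewrite -(eq_avg phil2) -(eq_avg phir2) av1' av2'.
- split => //.
  rewrite esum_dyadic//; last first.
    by move=> J _; rewrite lee_fin mulr_ge0// sqr_ge0.
  rewrite (eq_esum (I := dyadic (left_half I))
      (b := fun J => (avg J phi1 ^+ 2 * alpha1 J)%:E)); last first.
    move=> J hJ; rewrite alphal// (@eq_avg J phi phi1)// => t /set_mem tJ.
    by rewrite phil//; apply/mem_set; exact: dyadic_sub tJ.
  rewrite (eq_esum (I := dyadic (right_half I))
      (b := fun J => (avg J phi2 ^+ 2 * alpha2 J)%:E)); last first.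
    move=> J hJ; rewrite alphar// (@eq_avg J phi phi2)// => t /set_mem tJ.
    by rewrite phir//; apply/mem_set; exact: dyadic_sub tJ.
  rewrite su1' su2' alphaI av -!EFinD len_left_half// len_right_half//.
  by congr _%:E; field.
- move=> J; rewrite dyadic_setU => -[->|[hJ|hJ]].
  + by rewrite sumI lee_fin ler_pM2r// ler_piMr.
  + by rewrite suml//; exact: bd1.
  + by rewrite sumr//; exact: bd2.
Qed.

(** The interval is quantified after the tree, so that the induction hypotheses apply to the two
    halves. *)
Lemma realizes_reach D x1 x2 z v : 0 <= D -> reach x1 x2 z v ->
  forall I, nontrivial_itv I ->
  exists phi alpha, realizes D I phi alpha x1 x2 z v.
Proof.
move=> D0; elim=> {x1 x2 z v} [c d d01 I hI|].
  by do 2 eexists; exact: realizes_leaf.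
move=> x1 x2 z v y1 y2 w u d _ ih1 _ ih2 d0 zw I hI.
have [phi1 [alpha1 r1]] := ih1 _ (nontrivial_left_half hI).
have [phi2 [alpha2 r2]] := ih2 _ (nontrivial_right_half hI).
by do 2 eexists; exact: realizes_node r1 r2 d0 zw.
Qed.

(** The measure [m] times Lebesgue secures the lower Carleson bound on every interval and
    contributes [m * x2]; the coefficients contribute [(M - m) * v]. *)
Lemma reach_bellman_ge (m M x1 x2 x3 v : R) I : 0 <= m -> m < M ->
  nontrivial_itv I -> reach x1 x2 ((x3 - m) / (M - m)) v ->
  ((m * x2 + (M - m) * v)%:E <= bellman_CET I x1 x2 x3 m M)%E.
Proof.
move=> m0 mM hI hv; have D0 : 0 <= M - m by rewrite subr_ge0 ltW.
have [phi [alpha [sq a0 [av av'] [su su'] bd]]] := realizes_reach D0 hv hI.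
have l0 := len_gt0 hI.
pose mu : {measure set (measurableTypeR R) -> \bar R} := mscale (NngNum m0) leb.
have muE (A : set (measurableTypeR R)) : mu A = (m%:E * leb A)%E by [].
have mI : measurable ([set` I] : set (measurableTypeR R)) by exact: measurable_itv.
apply: ereal_sup_ubound; exists phi, mu, alpha; split.
  split => //.
  - split => // t _; by rewrite muE lebesgue_measure_set1 mule0.
  - rewrite /carleson_mass muE lebesgue_measure_len// su -EFinM.
    by congr _%:E; field; rewrite !gt_eqF// subr_gt0.
  - move=> J IJ; have hJ := nontrivial_dyadic hI IJ.
    rewrite /carleson_mass muE lebesgue_measure_len// -EFinM.
    rewrite leeDl ?esum_ge0//; last by move=> K _; rewrite lee_fin.
    have -> : M * len J = m * len J + (M - m) * len J by ring.
    by rewrite EFinD leeD2l// bd.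
rewrite /carleson_value.
under eq_integral do rewrite real_normK ?num_real//.
under eq_esum => K _ do rewrite real_normK ?num_real//.
rewrite su' ge0_integral_mscale//; last 2 first.
- by case: sq => mphi _; exact/measurable_EFinP/measurable_funX.
- by move=> t _; rewrite lee_fin sqr_ge0.
have -> : (\int[leb]_(t in [set` I]) (phi t ^+ 2)%:E = (x2 * len I)%:E)%E.
  rewrite -av' /avg mulrAC mulVf ?gt_eqF// mul1r /Rintegral fineK//.
  by case: sq => _; exact: integrable_fin_num.
rewrite -EFinM; congr _%:E.
by rewrite [_%:num]/=; field; rewrite gt_eqF.
Qed.

End realization.

(** * The Bellman function *)

(** Covers the root [a = 0], which occurs when [x1 ^+ 2 = x2]: as [a] decreases to 0 the majorants
    tend to [x3 * x2]. *)
Lemma majorant_small (R : realFieldType) (m M x2 x3 e : R) (x1 : R) :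
  m < M -> m <= x3 -> x3 <= M -> x1 ^+ 2 = x2 -> 0 < e ->
  exists2 a, 0 < a <= (4 * (M - m))^-1 &
    majorant a m M x1 x2 x3 <= x3 * x2 + e.
Proof.
move=> mM mx xM x12 e0.
have D0 : 0 < M - m by lra.
have x20 : 0 <= x2 by rewrite -x12 sqr_ge0.
set c := x2 * (x3 - m); have c0 : 0 <= c by rewrite mulr_ge0// subr_ge0.
(* With [a = h / (4 (M - m))] the excess over [m * x2] is [c / (s * t)], at most [c * (1 + 2 * h)],
   and [2 * c * h <= e]. *)
pose h := Num.min (1 / 2) (e / (2 * c + 1)).
have h0 : 0 < h by rewrite lt_min !divr_gt0//; lra.
have h2 : h <= 1 / 2 by rewrite ge_min lexx.
have hc : 2 * c * h <= e.
  have : h * (2 * c + 1) <= e.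
    by rewrite -ler_pdivlMr ?ge_min ?lexx ?orbT//; lra.
  by apply: le_trans; lra.
have a0 : 0 < h * (4 * (M - m))^-1 by rewrite mulr_gt0// invr_gt0 mulr_gt0.
have a1 : h * (4 * (M - m))^-1 <= (4 * (M - m))^-1.
  by rewrite ler_piMl ?invr_ge0 ?mulr_ge0 ?(ltW D0)//; lra.
exists (h * (4 * (M - m))^-1); first by rewrite a0 a1.
have [t0 ts s1] := majorant_denom mM a0 a1 mx xM.
have aD : h * (4 * (M - m))^-1 * (M - m) = h / 4.
  by field; rewrite gt_eqF.
rewrite /majorant x12; move: aD a0 t0 ts s1.
set a := h * (4 * (M - m))^-1 => aD a0.
set t := 1 - 2 * a * (M - m); set s := 1 - 2 * a * (M - x3) => t0 ts s1.
have s0 : 0 < s := lt_le_trans t0 ts.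
have -> : (2 * a)^-1 * (x2 / t - x2 / s) = c / (s * t).
  have -> : c = x2 * ((s - t) / (2 * a)).
    by rewrite /c /s /t; congr (_ * _); field; rewrite gt_eqF.
  by field; rewrite !gt_eqF.
have tE : t = 1 - h / 2 by rewrite /t -mulrA aD; field.
have st : 1 <= (1 + 2 * h) * (s * t).
  have : t * t <= s * t by rewrite ler_pM2r.
  have : t * t = 1 - h + h * h / 4 by rewrite tE; field.
  move=> tt st; apply: (@le_trans _ _ ((1 + 2 * h) * (t * t))).
    rewrite tt; have : 0 <= h * h by rewrite mulr_ge0// ltW.
    have : 0 <= h * h * h by rewrite !mulr_ge0// ltW.
    have : h * h <= h * (1 / 2) by rewrite ler_pM2l.
    by lra.
  by rewrite ler_wpM2l//; lra.
have : c / (s * t) <= c * (1 + 2 * h).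
  by rewrite ler_pdivrMr ?mulr_gt0// -mulrA ler_peMr.
have -> : x3 * x2 = c + m * x2 by rewrite /c; ring.
lra.
Qed.

Section bellman_function.
Variable R : realType.
Variables m M : R.
Hypotheses (m0 : 0 <= m) (mM : m < M).
Implicit Types (I J : interval R) (phi : R -> R).
Implicit Types (mu : {measure set (measurableTypeR R) -> \bar R}).

Lemma admissible_density I x1 x2 x3 phi mu alpha : nontrivial_itv I ->
  admissible I m M x1 x2 x3 phi mu alpha ->
  carleson_bounds mu alpha m M I /\ carleson_density mu alpha I = x3.
Proof.
move=> hI [[_ _ a0] _ _ e hb].
have b : carleson_bounds mu alpha m M I.
  by move=> J IJ; split; [exact: a0 | exact: hb].
split => //; have [h _ _] := carleson_densityP hI b.
move: e; rewrite h -EFinM => -[]; rewrite mulKf// gt_eqF// len_gt0//.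
Qed.

Lemma bellman_CET_le_majorant I a x1 x2 x3 : nontrivial_itv I ->
  0 < a <= (4 * (M - m))^-1 ->
  (bellman_CET I x1 x2 x3 m M <= (majorant a m M x1 x2 x3)%:E)%E.
Proof.
move=> hI /andP[a0 aM].
apply: ge_ereal_sup => _ [phi [mu [alpha [adm ->]]]].
have [hb <-] := admissible_density hI adm.
case: adm => -[sq _ _] <- <- _ _.
apply: (carleson_value_le _ _ hI sq _ hb); last exact: le_trans (ltW mM).
  by move=> *; apply: majorant_ge.
by move=> *; apply: majorant_main.
Qed.

(* For x3 = m the lower constraint is tight on I, hence on all of its dyadic
   subintervals, and m may serve as upper constant. *)
Lemma carleson_bounds_min I mu alpha : nontrivial_itv I ->
  carleson_bounds mu alpha m M I -> carleson_density mu alpha I = m ->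
  carleson_bounds mu alpha m m I.
Proof.
move=> hI hb dI.
have dJ J : dyadic I J -> carleson_density mu alpha J = m.
  have half K : dyadic I K -> carleson_density mu alpha K = m ->
      carleson_density mu alpha (left_half K) = m /\
      carleson_density mu alpha (right_half K) = m.
    move=> IK; have hK := nontrivial_dyadic hI IK.
    have bK := carleson_bounds_dyadic IK hb.
    rewrite (carleson_density_halves hK bK).
    have [_ h1 _] := carleson_densityP (nontrivial_left_half hK)
      (carleson_bounds_dyadic (dyadic_left_half K) bK).
    have [_ h2 _] := carleson_densityP (nontrivial_right_half hK)
      (carleson_bounds_dyadic (dyadic_right_half K) bK).
    have h3 : 0 <= alpha K / len K.
      by rewrite divr_ge0 ?(ltW (len_gt0 hK))//; have [] := hb _ IK.
    by move=> h; split; lra.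
  by elim=> {J} [//|J /half h /h[]|J /half h /h[]].
move=> J IJ; have hJ := nontrivial_dyadic hI IJ.
have [aJ _] := hb _ IJ; split => //.
have [-> _ _] := carleson_densityP hJ (carleson_bounds_dyadic IJ hb).
by rewrite dJ// mulrC lexx.
Qed.

Lemma bellman_CET_min I x1 x2 : nontrivial_itv I -> x1 ^+ 2 <= x2 ->
  bellman_CET I x1 x2 m m M = (m * x2)%:E.
Proof.
move=> hI x12; apply/eqP; rewrite eq_le; apply/andP; split.
  apply: ge_ereal_sup => _ [phi [mu [alpha [adm ->]]]].
  have [/(carleson_bounds_min hI) hb /hb {}hb] := admissible_density hI adm.
  case: adm => -[sq _ _] _ <- _ _.
  (* With [m] as both constants, the node condition forces [d = 0], so the linear function [m * x2]
     is good enough. *)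
  apply: (carleson_value_le (b := fun _ y _ => m * y) _ _ hI sq m0 hb).
    move=> y1 y2 y3 y12 my ym; have -> : y3 = m by lra.
    by rewrite mulrC ler_wpM2l.
  move=> y1 y2 y3 z1 z2 z3 d _ my _ mz d0 dm.
  have -> : d = 0 by lra.
  by rewrite mulr0 addr0; lra.
have D0 : 0 < M - m by rewrite subr_gt0.
have [|v hv] := @reach_any _ x1 x2 ((m - m) / (M - m)) x12.
  by rewrite subrr mul0r lexx ler01.
apply: le_trans (reach_bellman_ge m0 mM hI hv).
by have [_ _ v0] := reach_dom hv; rewrite lee_fin lerDl mulr_ge0// ltW.
Qed.

Lemma bellman_CET_zero I x3 : nontrivial_itv I -> m <= x3 -> x3 <= M ->
  bellman_CET I 0 0 x3 m M = 0%E.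
Proof.
move=> hI mx xM; have D0 : 0 < M - m by rewrite subr_gt0.
apply/eqP; rewrite eq_le; apply/andP; split.
  apply: le_trans (bellman_CET_le_majorant (a := (4 * (M - m))^-1) _ _ _ hI _) _.
    by rewrite lexx invr_gt0 mulr_gt0.
  by rewrite /majorant expr0n /= !mul0r mulr0 subrr mulr0 addr0.
have [||v hv] := @reach_any _ 0 0 ((x3 - m) / (M - m)).
- by rewrite expr0n.
- apply/andP; split; first by rewrite divr_ge0 ?subr_ge0// ltW.
  by rewrite ler_pdivrMr// mul1r lerD2r.
apply: le_trans (reach_bellman_ge m0 mM hI hv).
have [_ _ v0] := reach_dom hv.
by rewrite lee_fin mulr0 add0r mulr_ge0// ltW.
Qed.

Lemma bellman_CET_cubic I a x1 x2 x3 : nontrivial_itv I ->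
  m < x3 -> x3 <= M -> 0 < x2 -> solves_cubic x1 x2 x3 m M a ->
  bellman_CET I x1 x2 x3 m M =
    ((x3 - m) * x2 / ((1 - 2 * a * (M - m)) ^+ 2 * (1 - 4 * a * (M - x3)))
      + m * x2)%:E.
Proof.
move=> hI mx xM x20 sa; have D0 : 0 < M - m by rewrite subr_gt0.
apply/eqP; rewrite eq_le; apply/andP; split.
  have [/andP[a0 aM] cub] := sa.
  (* A positive root gives the upper bound by its own majorant; the root 0 means [x1 ^+ 2 = x2] and
     needs the limit of small [a]. *)
  move: a0; rewrite [0 <= a]le_eqVlt => /predU1P[a0|a0]; last first.
    rewrite -(majorant_cubic mx xM x20 a0 sa).
    by apply: bellman_CET_le_majorant => //; rewrite a0.
  have x12 : x1 ^+ 2 = x2.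
    move: cub; rewrite -a0 !(mulr0, mul0r, subr0, divr1, expr1n, mulr1) => h.
    by apply: (divIf (lt0r_neq0 x20)); rewrite h divff// gt_eqF.
  rewrite -a0 !(mulr0, mul0r, subr0, expr1n, mulr1, divr1).
  apply/lee_addgt0Pr => e e0; rewrite -EFinD.
  have [b ab hb] := majorant_small mM (ltW mx) xM x12 e0.
  apply: le_trans (bellman_CET_le_majorant x1 x2 x3 hI ab) _.
  by rewrite lee_fin; apply: le_trans hb _; lra.
apply/lee_addgt0Pr => e e0.
(* The tolerance is [e / (M - m)] because [v] will be multiplied by [M - m]. *)
have [v hv bv] := reach_sup_cubic mx xM x20 sa (divr_gt0 e0 D0).
apply: (@le_trans _ _ ((m * x2 + (M - m) * v)%:E + e%:E)); last first.
  by rewrite leeD2r// reach_bellman_ge.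
rewrite -EFinD lee_fin [leLHS]addrC -addrA lerD2l.
move: bv => /ltW; rewrite -(ler_pM2l D0) mulrBr lerBlDr.
rewrite (mulrC _ (e / _)) divfK ?gt_eqF//; apply: le_trans.
rewrite le_eqVlt; apply/orP; left; apply/eqP.
by move: (_ ^+ 2 * _)^-1 => q; field; rewrite gt_eqF.
Qed.

End bellman_function.

Unset Implicit Arguments.

Theorem theorem3 (R : realType) (m M : R) (hm : 0 <= m) (hmM : m < M) :
  (forall x1 x2 x3 : R, x1 ^+ 2 <= x2 -> m < x3 -> x3 <= M ->
     ~ (x1 = 0 /\ x2 = 0) ->
     exists! a : R, solves_cubic x1 x2 x3 m M a) /\
  (forall (l r : R) (bl br : bool), l < r ->
   let I := Interval (BSide bl l) (BSide br r) in
   forall x1 x2 x3 : R, x1 ^+ 2 <= x2 -> m <= x3 -> x3 <= M ->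
     bellman_CET I x1 x2 x3 m M =
       (if x3 == m then m * x2 else bellman_B x1 x2 x3 m M)%:E).
Proof.
have x2_gt0 (x1 x2 : R) : x1 ^+ 2 <= x2 -> ~ (x1 = 0 /\ x2 = 0) -> 0 < x2.
  move=> x12 nz; rewrite lt_neqAle (le_trans (sqr_ge0 _) x12) andbT.
  apply/eqP => x20; apply: nz; split => //; apply/eqP.
  by rewrite -sqrf_eq0 eq_le sqr_ge0 andbT x20.
split=> [x1 x2 x3 x12 mx xM /(x2_gt0 _ _ x12) x20|].
  have [a sa] := cubic_root_exists hmM x12 mx xM x20.
  by exists a; split => // b; exact: cubic_root_unique sa.
move=> l r bl br lr I x1 x2 x3 x12 mx xM.
have hI : nontrivial_itv I by split.
case: eqVneq => [->|x3m]; first exact: bellman_CET_min.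
have {}mx : m < x3 by rewrite lt_neqAle eq_sym x3m.
rewrite /bellman_B; case: ifPn => [/andP[/eqP -> /eqP ->]|nz].
  exact: bellman_CET_zero (ltW mx) xM.
have x20 : 0 < x2.
  by apply: (x2_gt0 _ _ x12) => -[x10 x20]; move: nz; rewrite x10 x20 eqxx.
(* Since a root exists, [xget] returns a genuine root and not its default 0. *)
have sa : solves_cubic x1 x2 x3 m M (cubic_root x1 x2 x3 m M).
  have [a sa] := cubic_root_exists hmM x12 mx xM x20.
  exact: (xgetPex 0 (ex_intro _ a sa)).
exact: bellman_CET_cubic.
Qed.
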